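(* The following is provable in $\mathbf{ZF}$. Let $\mathbf{X}$ be an infinite topological space. (i) $\mathbf{X}$ admits a denumerable locally finite family of clopen sets if and only if $\mathbf{X}$ admits a denumerable cellular locally finite family of clopen sets. (ii) $\mathbf{X}$ admits a denumerable locally finite cellular family with a dense union if and only if $\mathbf{X}$ admits a denumerable locally finite family of open sets. (iii) $\mathbf{X}$ admits an infinite locally finite cellular family with a dense union if and only if $\mathbf{X}$ admits an infinite locally finite family of open sets.
   Context: The base theory is $\mathbf{ZF}$, with no form of the axiom of choice assumed. A set is infinite if it is not equipotent with any $n\in\omega$, and denumerable if it is equipotent with $\omega$. Families are sets of subsets of $X$. A family of subsets is locally finite if every point of $\mathbf{X}$ has a neighborhood which meets only finitely many members of the family. A cellular family is a set of pairwise disjoint non-empty open subsets of $\mathbf{X}$. *)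

(* Defs.v *)
From Stdlib Require Import List.

(** "Provable in ZF" is rendered literally: first-order formulas over the
    signature with one binary relation symbol (membership) and equality, a
    classical natural-deduction calculus, the axioms and schemas of ZF (without
    Choice), and derivability of a closed formula.  In this way no choice
    principle or other axiom of the ambient logic can leak into the object
    theory. *)

(* De Bruijn indices.  There are no function symbols, so the only terms are
   variables and substitution is renaming. *)
Inductive form : Type :=
| Mem : nat -> nat -> form
| Eq  : nat -> nat -> form
| Bot : form
| And : form -> form -> form
| Or  : form -> form -> form
| Imp : form -> form -> form
| All : form -> form
| Ex  : form -> form.

Definition up (r : nat -> nat) (i : nat) : nat :=
  match i with 0 => 0 | S j => S (r j) end.

Fixpoint ren (r : nat -> nat) (p : form) : form :=
  match p with
  | Mem i j => Mem (r i) (r j)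
  | Eq i j  => Eq (r i) (r j)
  | Bot     => Bot
  | And p q => And (ren r p) (ren r q)
  | Or p q  => Or (ren r p) (ren r q)
  | Imp p q => Imp (ren r p) (ren r q)
  | All p   => All (ren (up r) p)
  | Ex p    => Ex (ren (up r) p)
  end.

Definition shift : form -> form := ren S.

(* [inst t p] is p[t/0], the variables above 0 being lowered by one. *)
Definition inst (t : nat) : form -> form :=
  ren (fun i => match i with 0 => t | S j => j end).

(* An axiom may be used under any hypotheses, even ones mentioning its free
   variables, so an axiom with free variables stands for its universal closure
   (rules [prv_ax] and [prv_allI]). *)
Inductive prv (T : form -> Prop) : list form -> form -> Prop :=
| prv_ax G p : T p -> prv T G p
| prv_hyp G p : In p G -> prv T G p
| prv_raa G p : prv T (Imp p Bot :: G) Bot -> prv T G p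
| prv_impI G p q : prv T (p :: G) q -> prv T G (Imp p q)
| prv_impE G p q : prv T G (Imp p q) -> prv T G p -> prv T G q
| prv_andI G p q : prv T G p -> prv T G q -> prv T G (And p q)
| prv_andE1 G p q : prv T G (And p q) -> prv T G p
| prv_andE2 G p q : prv T G (And p q) -> prv T G q
| prv_orI1 G p q : prv T G p -> prv T G (Or p q)
| prv_orI2 G p q : prv T G q -> prv T G (Or p q)
| prv_orE G p q r :
    prv T G (Or p q) -> prv T (p :: G) r -> prv T (q :: G) r -> prv T G r
| prv_allI G p : prv T (map shift G) p -> prv T G (All p)
| prv_allE G p t : prv T G (All p) -> prv T G (inst t p)
| prv_exI G p t : prv T G (inst t p) -> prv T G (Ex p)
| prv_exE G p q :
    prv T G (Ex p) -> prv T (p :: map shift G) (shift q) -> prv T G q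
| prv_eqI G t : prv T G (Eq t t)
| prv_eqE G p s t :
    prv T G (Eq s t) -> prv T G (inst s p) -> prv T G (inst t p).

(* A [pform] maps the number [d] of enclosing binders to a formula.  The
   variable bound by the k-th enclosing binder (counted from the outside, from
   0) is denoted by its level k; below d binders it has index d - 1 - k.
   [close] yields the formula standing under no binder. *)
Definition pform : Type := nat -> form.

Definition pMem (x y : nat) : pform := fun d => Mem (d - S x) (d - S y).
Definition pEq (x y : nat) : pform := fun d => Eq (d - S x) (d - S y).
Definition pBot : pform := fun _ => Bot.
Definition pAnd (P Q : pform) : pform := fun d => And (P d) (Q d).
Definition pOr (P Q : pform) : pform := fun d => Or (P d) (Q d).
Definition pImp (P Q : pform) : pform := fun d => Imp (P d) (Q d).
Definition pAll (P : nat -> pform) : pform := fun d => All (P d (S d)).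
Definition pEx (P : nat -> pform) : pform := fun d => Ex (P d (S d)).
Definition pNot (P : pform) : pform := pImp P pBot.
Definition pIff (P Q : pform) : pform := pAnd (pImp P Q) (pImp Q P).

Definition close (P : pform) : form := P 0.

Declare Scope zf_scope.
Delimit Scope zf_scope with zf.
Bind Scope zf_scope with pform.

Notation "x ∈ y" := (pMem x y) (at level 70, no associativity) : zf_scope.
Notation "x ≡ y" := (pEq x y) (at level 70, no associativity) : zf_scope.
Notation "¬ P" := (pNot P) (at level 75, right associativity) : zf_scope.
Notation "P ∧ Q" := (pAnd P Q) (at level 80, right associativity) : zf_scope.
Notation "P ∨ Q" := (pOr P Q) (at level 85, right associativity) : zf_scope.
Notation "P ↔ Q" := (pIff P Q) (at level 95, no associativity) : zf_scope.
Notation "P → Q" := (pImp P Q)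
  (at level 99, Q at level 200, right associativity) : zf_scope.
Notation "∀ x .. y , P" := (pAll (fun x => .. (pAll (fun y => P)) ..))
  (at level 200, x binder, y binder, right associativity) : zf_scope.
Notation "∃ x .. y , P" := (pEx (fun x => .. (pEx (fun y => P)) ..))
  (at level 200, x binder, y binder, right associativity) : zf_scope.

Local Open Scope zf_scope.

Definition is_subset (a b : nat) : pform := ∀ z, z ∈ a → z ∈ b.
Definition is_empty (a : nat) : pform := ∀ z, ¬ z ∈ a.
Definition is_union (u a : nat) : pform := ∀ z, z ∈ u ↔ ∃ y, y ∈ a ∧ z ∈ y.
Definition is_inter2 (c a b : nat) : pform := ∀ z, z ∈ c ↔ z ∈ a ∧ z ∈ b.
Definition is_diff (c a b : nat) : pform := ∀ z, z ∈ c ↔ z ∈ a ∧ ¬ z ∈ b.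
Definition meets (a b : nat) : pform := ∃ z, z ∈ a ∧ z ∈ b.

Definition is_succ (s n : nat) : pform := ∀ z, z ∈ s ↔ z ∈ n ∨ z ≡ n.
Definition is_inductive (w : nat) : pform :=
  (∃ e, is_empty e ∧ e ∈ w) ∧ (∀ n, n ∈ w → ∃ s, is_succ s n ∧ s ∈ w).
Definition is_omega (w : nat) : pform :=
  is_inductive w ∧ ∀ v, is_inductive v → is_subset w v.

Definition is_pair (p a b : nat) : pform := ∀ z, z ∈ p ↔ z ≡ a ∨ z ≡ b.
(* Kuratowski: p = {{a}, {a, b}}. *)
Definition is_opair (p a b : nat) : pform :=
  ∃ u v, is_pair u a a ∧ is_pair v a b ∧ is_pair p u v.
Definition maps_to (f x y : nat) : pform := ∃ p, is_opair p x y ∧ p ∈ f.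

Definition is_bijection (f a b : nat) : pform :=
  (∀ p, p ∈ f → ∃ x y, x ∈ a ∧ y ∈ b ∧ is_opair p x y) ∧
  (∀ x, x ∈ a → ∃ y, maps_to f x y ∧ ∀ y', maps_to f x y' → y' ≡ y) ∧
  (∀ y, y ∈ b → ∃ x, maps_to f x y ∧ ∀ x', maps_to f x' y → x' ≡ x).
Definition equipotent (a b : nat) : pform := ∃ f, is_bijection f a b.

Definition finite (a : nat) : pform :=
  ∃ w, is_omega w ∧ ∃ n, n ∈ w ∧ equipotent a n.
Definition infinite (a : nat) : pform := ¬ finite a.
Definition denumerable (a : nat) : pform := ∃ w, is_omega w ∧ equipotent a w.

(* The formula [p] with its variables 0 and 1 standing for x and y; its variable
   i + 2 is the parameter i, i.e. the free variable i outside all binders, so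
   that no binder of the schemas below captures it. *)
Definition inst2 (p : form) (x y : nat) : pform := fun d =>
  ren (fun i => match i with
                | 0 => d - S x
                | 1 => d - S y
                | S (S k) => d + k
                end) p.

(* Likewise with only variable 0 bound, and parameters from variable 1 on. *)
Definition inst1 (p : form) (x : nat) : pform := fun d =>
  ren (fun i => match i with 0 => d - S x | S k => d + k end) p.

Definition ax_extensionality : form := close (
  ∀ a b, (∀ z, z ∈ a ↔ z ∈ b) → a ≡ b).
Definition ax_foundation : form := close (
  ∀ a, (∃ x, x ∈ a) → ∃ x, x ∈ a ∧ ¬ meets x a).
Definition ax_pairing : form := close (∀ a b, ∃ p, is_pair p a b).
Definition ax_union : form := close (∀ a, ∃ u, is_union u a).
Definition ax_powerset : form := close (
  ∀ a, ∃ p, ∀ z, z ∈ p ↔ is_subset z a).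
Definition ax_infinity : form := close (∃ w, is_inductive w).
Definition ax_separation (p : form) : form := close (
  ∀ a, ∃ b, ∀ x, x ∈ b ↔ x ∈ a ∧ inst1 p x).
Definition ax_replacement (p : form) : form := close (
  ∀ a,
    (∀ x, x ∈ a → ∀ y z, inst2 p x y → inst2 p x z → y ≡ z) →
    ∃ b, ∀ y, y ∈ b ↔ ∃ x, x ∈ a ∧ inst2 p x y).

Inductive ZF : form -> Prop :=
| ZF_extensionality : ZF ax_extensionality
| ZF_foundation : ZF ax_foundation
| ZF_pairing : ZF ax_pairing
| ZF_union : ZF ax_union
| ZF_powerset : ZF ax_powerset
| ZF_infinity : ZF ax_infinity
| ZF_separation p : ZF (ax_separation p)
| ZF_replacement p : ZF (ax_replacement p).

Definition provable_in_ZF (P : pform) : Prop := prv ZF nil (close P).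

(* Below, [T] is the set of open sets of the space [X]. *)

Definition topology (X T : nat) : pform :=
  (∀ U, U ∈ T → is_subset U X) ∧
  (∀ U, is_empty U → U ∈ T) ∧
  X ∈ T ∧
  (∀ S U, is_subset S T → is_union U S → U ∈ T) ∧
  (∀ U V W, U ∈ T → V ∈ T → is_inter2 W U V → W ∈ T).

Definition clopen (X T A : nat) : pform :=
  A ∈ T ∧ ∃ C, is_diff C X A ∧ C ∈ T.

Definition neighborhood (X T N x : nat) : pform :=
  is_subset N X ∧ ∃ U, U ∈ T ∧ x ∈ U ∧ is_subset U N.

Definition dense (X T D : nat) : pform :=
  is_subset D X ∧ ∀ U, U ∈ T → (∃ z, z ∈ U) → meets U D.

Definition family (X F : nat) : pform := ∀ A, A ∈ F → is_subset A X.

Definition locally_finite (X T F : nat) : pform :=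
  family X F ∧
  ∀ x, x ∈ X → ∃ N, neighborhood X T N x ∧
    ∃ G, (∀ A, A ∈ G ↔ A ∈ F ∧ meets A N) ∧ finite G.

Definition open_family (T F : nat) : pform := ∀ A, A ∈ F → A ∈ T.
Definition clopen_family (X T F : nat) : pform := ∀ A, A ∈ F → clopen X T A.

Definition cellular (T F : nat) : pform :=
  (∀ A, A ∈ F → A ∈ T ∧ ∃ z, z ∈ A) ∧
  (∀ A B, A ∈ F → B ∈ F → ¬ A ≡ B → ¬ meets A B).

Definition has_dense_union (X T F : nat) : pform :=
  ∃ D, is_union D F ∧ dense X T D.

(* Main.v *)
(** By Henkin's completeness theorem for the calculus it suffices to argue in an
    arbitrary model of ZF, where Separation is available for the predicates
    that some first-order formula defines.

    For (i) and (ii), enumerate the family as A_0, A_1, ..., replace A_0 by X,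
    and put D_n = A_n \ cl(A_(n+1) ∪ A_(n+2) ∪ ...).  These open sets are
    pairwise disjoint, and clopen if the A_n are.  If an open set V meets A_n
    and, after shrinking, only finitely many later A_m, then the last A_m that
    V meets yields a D_m meeting V; so the union of the D_n is dense and
    infinitely many D_n are nonempty.  An infinite set of natural numbers is
    denumerable, hence so is the family of nonempty D_n.

    For (iii) no enumeration is available.  Call a nonempty open V homogeneous
    if every member of the family meeting V contains V.  Local finiteness
    yields a homogeneous set below every nonempty open set, and the maximal
    homogeneous sets are pairwise disjoint.  Finitely many of them would meet
    only finitely many members of the family, as each member meeting a
    homogeneous V contains a fixed point of V. *)

Require Import Defs.
From Stdlib Require Import List PeanoNat Lia Cantor Classical ClassicalEpsilon
  FunctionalExtensionality PropExtensionality Eqdep_dec.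
Import ListNotations.

(** * Renaming and the natural deduction calculus *)

Definition scons {A : Type} (x : A) (v : nat -> A) (i : nat) : A :=
  match i with 0 => x | S j => v j end.

Lemma ren_ext (p : form) (r s : nat -> nat) :
  (forall i, r i = s i) -> ren r p = ren s p.
Proof.
  revert r s; induction p; intros r s H; simpl; f_equal; auto;
    apply IHp; intros [|i]; simpl; auto.
Qed.

Lemma ren_comp (p : form) (r s : nat -> nat) :
  ren r (ren s p) = ren (fun i => r (s i)) p.
Proof.
  revert r s; induction p; intros r s; simpl; f_equal; auto;
    rewrite IHp; apply ren_ext; intros [|i]; reflexivity.
Qed.

Lemma ren_id (p : form) : ren (fun i => i) p = p.
Proof.
  induction p; simpl; f_equal; auto;
    rewrite <- IHp at 2; apply ren_ext; intros [|i]; reflexivity.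
Qed.

Fixpoint fv_bound (p : form) : nat :=
  match p with
  | Mem i j | Eq i j => S (max i j)
  | Bot => 0
  | And p q | Or p q | Imp p q => max (fv_bound p) (fv_bound q)
  | All p | Ex p => pred (fv_bound p)
  end.

Lemma ren_agree (p : form) (r s : nat -> nat) :
  (forall i, i < fv_bound p -> r i = s i) -> ren r p = ren s p.
Proof.
  revert r s; induction p; intros r s H; simpl in *; f_equal;
    try (apply H; lia);
    try (apply IHp1; intros; apply H; lia);
    try (apply IHp2; intros; apply H; lia);
    try (apply IHp; intros [|i] Hi; simpl; auto; f_equal; apply H; lia).
  reflexivity.
Qed.

Lemma ren_up_shift (r : nat -> nat) (p : form) :
  ren (up r) (shift p) = shift (ren r p).
Proof. unfold shift; rewrite !ren_comp; apply ren_ext; reflexivity. Qed.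

Lemma ren_up_shift_map (r : nat -> nat) (G : list form) :
  map (ren (up r)) (map shift G) = map shift (map (ren r) G).
Proof. rewrite !map_map; apply map_ext; intros; apply ren_up_shift. Qed.

Lemma ren_inst (r : nat -> nat) (t : nat) (p : form) :
  ren r (inst t p) = inst (r t) (ren (up r) p).
Proof.
  unfold inst; rewrite !ren_comp; apply ren_ext; intros [|i]; reflexivity.
Qed.

Lemma inst_ren_up (r : nat -> nat) (t : nat) (p : form) :
  inst t (ren (up r) p) = ren (scons t r) p.
Proof.
  unfold inst; rewrite ren_comp; apply ren_ext; intros [|i]; reflexivity.
Qed.

(** * Weakening, cut and renaming of derivations *)

Lemma prv_weaken (T : form -> Prop) (G G' : list form) (p : form) :
  prv T G p -> incl G G' -> prv T G' p.
Proof.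
  intros H; revert G'; induction H; intros G' HG.
  - now apply prv_ax.
  - apply prv_hyp; auto.
  - apply prv_raa, IHprv; intros x [<-|Hx]; simpl; auto.
  - apply prv_impI, IHprv; intros x [<-|Hx]; simpl; auto.
  - eapply prv_impE; eauto.
  - apply prv_andI; auto.
  - eapply prv_andE1; eauto.
  - eapply prv_andE2; eauto.
  - apply prv_orI1; auto.
  - apply prv_orI2; auto.
  - eapply prv_orE; [eauto | apply IHprv2 | apply IHprv3];
      intros x [<-|Hx]; simpl; auto.
  - apply prv_allI, IHprv, incl_map, HG.
  - apply prv_allE; auto.
  - eapply prv_exI; eauto.
  - eapply prv_exE; [eauto | apply IHprv2].
    intros x [<-|Hx]; simpl; auto.
    right; eapply incl_map; eauto.
  - apply prv_eqI.
  - eapply prv_eqE; eauto.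
Qed.

Lemma prv_cut (T : form -> Prop) (G : list form) (p q : form) :
  prv T G p -> prv T (p :: G) q -> prv T G q.
Proof. intros Hp Hq; eapply prv_impE; [apply prv_impI, Hq | exact Hp]. Qed.

(* Instantiating the [n] outermost variables one after the other realizes an
   arbitrary renaming of them; each value is raised beforehand by the number
   of instantiations still to come. *)
Lemma prv_valid_ren (T : form -> Prop) (p : form) (r : nat -> nat) :
  (forall G, prv T G p) -> forall G, prv T G (ren r p).
Proof.
  assert (Hn : forall n p r, (forall G, prv T G p) ->
    forall G, prv T G (ren (fun i => if i <? n then r i else i - n) p)).
  { clear; induction n as [|n IH]; intros p r Hp G.
    - rewrite (ren_ext _ _ (fun i => i)), ren_id; auto.
      intros i; simpl; lia.
    - specialize (IH (inst (r 0 + n) p) (fun i => r (S i))).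
      unfold inst in IH; rewrite ren_comp in IH.
      erewrite ren_ext; [apply IH|].
      + intros G'; apply prv_allE, prv_allI, Hp.
      + intros [|i]; simpl; auto.
        replace (r 0 + n <? n) with false; [lia|].
        symmetry; apply Nat.ltb_ge; lia. }
  intros Hp G.
  rewrite (ren_agree p r (fun i => if i <? fv_bound p then r i else i - fv_bound p));
    [now apply Hn|].
  intros i Hi; apply Nat.ltb_lt in Hi; now rewrite Hi.
Qed.

(** [T] need not be closed under renaming. An axiom is provable in every context, though, so its
    free variables can be generalized and instantiated again, which is [prv_valid_ren]; the other
    rules commute with renaming. *)
Lemma prv_ren (T : form -> Prop) (G : list form) (p : form) (rho : nat -> nat) :
  prv T G p -> prv T (map (ren rho) G) (ren rho p).
Proof.
  intros H; revert rho; induction H; intros rho; simpl in *.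
  - apply prv_valid_ren; intros; now apply prv_ax.
  - apply prv_hyp; now apply in_map.
  - apply prv_raa, IHprv.
  - apply prv_impI, IHprv.
  - eapply prv_impE; [apply IHprv1 | apply IHprv2].
  - apply prv_andI; auto.
  - eapply prv_andE1; apply IHprv.
  - eapply prv_andE2; apply IHprv.
  - apply prv_orI1; auto.
  - apply prv_orI2; auto.
  - eapply prv_orE; eauto.
  - apply prv_allI; rewrite <- ren_up_shift_map; apply IHprv.
  - rewrite ren_inst; apply prv_allE, IHprv.
  - apply prv_exI with (rho t); rewrite <- ren_inst; apply IHprv.
  - eapply prv_exE; [apply IHprv1|].
    rewrite <- ren_up_shift_map, <- ren_up_shift; apply IHprv2.
  - apply prv_eqI.
  - rewrite ren_inst; eapply prv_eqE; [apply IHprv1|].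
    rewrite <- ren_inst; apply IHprv2.
Qed.

(** Henkin witnesses are supplied for existential formulas only; this converts a refuted universal
    formula into one of them. *)
Lemma prv_not_all (T : form -> Prop) (G : list form) (p : form) :
  prv T G (Imp (All p) Bot) -> prv T G (Ex (Imp p Bot)).
Proof.
  intros H; apply prv_raa.
  eapply prv_impE; [eapply prv_weaken; [exact H | intros x; simpl; auto]|].
  apply prv_allI, prv_raa; simpl.
  eapply prv_impE; [apply prv_hyp; right; left; reflexivity|].
  apply prv_exI with 0; simpl.
  apply prv_hyp; left; unfold inst; simpl; f_equal.
  rewrite ren_comp, <- (ren_id p) at 1.
  apply ren_ext; intros [|i]; reflexivity.
Qed.

(** * Tarski semantics *)

Fixpoint sat {M : Type} (E : M -> M -> Prop) (v : nat -> M) (p : form) : Prop :=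
  match p with
  | Mem i j => E (v i) (v j)
  | Eq i j  => v i = v j
  | Bot     => False
  | And p q => sat E v p /\ sat E v q
  | Or p q  => sat E v p \/ sat E v q
  | Imp p q => sat E v p -> sat E v q
  | All p   => forall x, sat E (scons x v) p
  | Ex p    => exists x, sat E (scons x v) p
  end.

Lemma sat_ren {M : Type} (E : M -> M -> Prop) (p : form) (r : nat -> nat)
    (v w : nat -> M) :
  (forall i, v (r i) = w i) -> sat E v (ren r p) <-> sat E w p.
Proof.
  revert r v w; induction p; intros r v w H; simpl;
    rewrite ?H; try tauto;
    try (rewrite (IHp1 r v w), (IHp2 r v w) by auto; tauto).
  - split; intros Hx x; eapply (IHp (up r) (scons x v) (scons x w)); auto;
      intros [|i]; simpl; auto.
  - split; intros [x Hx]; exists x;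
      eapply (IHp (up r) (scons x v) (scons x w)); auto;
      intros [|i]; simpl; auto.
Qed.

Lemma sat_ext {M : Type} (E : M -> M -> Prop) (p : form) (v w : nat -> M) :
  (forall i, v i = w i) -> sat E v p <-> sat E w p.
Proof. intros H; rewrite <- (ren_id p) at 1; now apply sat_ren. Qed.

(** * Completeness by Henkin's construction *)

Fixpoint form_code (p : form) : nat :=
  match p with
  | Mem i j => to_nat (0, to_nat (i, j))
  | Eq i j  => to_nat (1, to_nat (i, j))
  | Bot     => to_nat (2, 0)
  | And p q => to_nat (3, to_nat (form_code p, form_code q))
  | Or p q  => to_nat (4, to_nat (form_code p, form_code q))
  | Imp p q => to_nat (5, to_nat (form_code p, form_code q))
  | All p   => to_nat (6, form_code p)
  | Ex p    => to_nat (7, form_code p)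
  end.

Lemma form_code_inj (p q : form) : form_code p = form_code q -> p = q.
Proof.
  revert q; induction p; intros [] H; cbn [form_code] in H;
    apply to_nat_inj, pair_equal_spec in H; destruct H as [Hh H];
    try discriminate Hh; auto; try (now f_equal; auto);
    apply to_nat_inj, pair_equal_spec in H; destruct H; f_equal; auto.
Qed.

(** The enumeration that drives the Henkin construction. A number that codes nothing yields an
    arbitrary formula, which is harmless because each stage tests consistency. *)
Definition form_decode (n : nat) : form :=
  epsilon (inhabits Bot) (fun p => form_code p = n).

Lemma form_codeK (p : form) : form_decode (form_code p) = p.
Proof.
  apply form_code_inj.
  exact (epsilon_spec (inhabits Bot) (fun q => form_code q = form_code p)
           (ex_intro _ p eq_refl)).
Qed.

Definition fresh (G : list form) : nat := list_max (map fv_bound G).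

Lemma fresh_spec (G : list form) (p : form) : In p G -> fv_bound p <= fresh G.
Proof.
  intros H; assert (Hl := list_max_le (map fv_bound G) (fresh G)).
  destruct Hl as [Hl _]; specialize (Hl (Nat.le_refl _)).
  rewrite Forall_forall in Hl; apply Hl, in_map, H.
Qed.

Section Henkin.
Variable T : form -> Prop.
Variable p0 : form.
Hypothesis p0_unprovable : ~ prv T [] p0.

Definition consistent (G : list form) : Prop := ~ prv T G Bot.

(** Free variables serve as Henkin constants, so the language stays the same: a finite context
    always leaves a fresh one. *)
Definition add_witness (G : list form) (p : form) : list form :=
  match p with
  | Ex q => inst (fresh (p :: G)) q :: p :: G
  | _ => p :: G
  end.

Lemma add_witness_incl G p : incl (p :: G) (add_witness G p).
Proof. destruct p; simpl; intros x Hx; simpl in *; tauto. Qed.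

Lemma add_witness_consistent G p :
  consistent (p :: G) -> consistent (add_witness G p).
Proof.
  destruct p; auto; simpl; set (c := fresh (Ex p :: G)).
  assert (Hc : forall q, In q (Ex p :: G) -> fv_bound q <= c)
    by apply fresh_spec.
  intros H Hb; apply H.
  (* This renaming moves the witness [c] to index 0 and shifts all other variables, which turns the
     derivation from the witnessed context into the second premise of [prv_exE]. *)
  set (r := fun i => if i =? c then 0 else S i).
  apply (prv_ren _ _ _ r) in Hb.
  eapply prv_exE; [apply prv_hyp; left; reflexivity|].
  assert (Hr : forall q, In q (Ex p :: G) -> ren r q = shift q).
  { intros q Hq; apply ren_agree; intros i Hi; specialize (Hc q Hq).
    unfold r; replace (i =? c) with false; auto.
    symmetry; apply Nat.eqb_neq; lia. }
  rewrite map_cons, (map_ext_in _ _ _ Hr) in Hb.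
  replace (ren r (inst c p)) with p in Hb; [exact Hb|].
  unfold inst; rewrite ren_comp, <- (ren_id p) at 1.
  apply ren_agree; intros [|i] Hi; unfold r.
  - now rewrite Nat.eqb_refl.
  - specialize (Hc _ (or_introl eq_refl)); simpl in Hc.
    replace (i =? c) with false; auto.
    symmetry; apply Nat.eqb_neq; lia.
Qed.

Fixpoint stage (n : nat) : list form :=
  match n with
  | 0 => [Imp p0 Bot]
  | S n => if excluded_middle_informative (consistent (form_decode n :: stage n))
           then add_witness (stage n) (form_decode n) else stage n
  end.

Lemma stage_consistent n : consistent (stage n).
Proof.
  induction n as [|n IH]; simpl.
  - intros H; apply p0_unprovable, prv_raa, H.
  - destruct excluded_middle_informative; auto.
    now apply add_witness_consistent.
Qed.

Lemma stage_mono m n : m <= n -> incl (stage m) (stage n).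
Proof.
  induction 1 as [|n _ IH]; [apply incl_refl|]; simpl.
  destruct excluded_middle_informative; auto.
  eapply incl_tran; [exact IH|].
  eapply incl_tran; [|apply add_witness_incl]; intros x; simpl; auto.
Qed.

(** * The maximal consistent theory and its closure properties *)

Definition limit (p : form) : Prop := exists n, In p (stage n).

(** Both stages lie in the later of the two, which is consistent. With [m] the code of [p], this
    shows that a formula derivable at any stage was accepted when its turn came. *)
Lemma stage_compatible n m p :
  prv T (stage n) p -> consistent (p :: stage m).
Proof.
  intros Hp Hb; apply (stage_consistent (max n m)).
  apply prv_cut with p.
  - eapply prv_weaken; [exact Hp | apply stage_mono; lia].
  - eapply prv_weaken; [exact Hb|].
    intros x [<-|Hx]; simpl; auto.
    right; revert Hx; apply stage_mono; lia.
Qed.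

Lemma stage_add p :
  consistent (p :: stage (form_code p)) ->
  incl (add_witness (stage (form_code p)) p) (stage (S (form_code p))).
Proof.
  intros H; simpl; rewrite form_codeK.
  destruct excluded_middle_informative; [apply incl_refl | contradiction].
Qed.

Lemma limit_of_consistent p :
  consistent (p :: stage (form_code p)) -> limit p.
Proof.
  intros H; exists (S (form_code p)).
  apply stage_add, add_witness_incl; simpl; auto.
Qed.

Lemma limit_closed (L : list form) (p : form) :
  (forall q, In q L -> limit q) -> prv T L p -> limit p.
Proof.
  intros HL Hp.
  assert (Hn : exists n, incl L (stage n)).
  { clear Hp; induction L as [|q L IH].
    - exists 0; intros x [].
    - destruct IH as [n Hn]; [intros; apply HL; simpl; auto|].
      destruct (HL q) as [m Hm]; [simpl; auto|].
      exists (max n m); intros x [<-|Hx].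
      + revert Hm; apply stage_mono; lia.
      + apply Hn in Hx; revert Hx; apply stage_mono; lia. }
  destruct Hn as [n Hn].
  apply limit_of_consistent, (stage_compatible n).
  eapply prv_weaken; eauto.
Qed.

Lemma limit_closed1 (q p : form) : limit q -> prv T [q] p -> limit p.
Proof. intros Hq; apply limit_closed; intros x [<-|[]]; auto. Qed.

Lemma limit_closed2 (q q' p : form) :
  limit q -> limit q' -> prv T [q; q'] p -> limit p.
Proof. intros Hq Hq'; apply limit_closed; intros x [<-|[<-|[]]]; auto. Qed.

Lemma limit_bot : ~ limit Bot.
Proof. intros [n Hn]; apply (stage_consistent n), prv_hyp, Hn. Qed.

Lemma limit_dec p : limit p \/ limit (Imp p Bot).
Proof.
  destruct (classic (consistent (p :: stage (form_code p)))) as [H|H].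
  - left; now apply limit_of_consistent.
  - right; apply NNPP in H.
    apply limit_closed with (stage (form_code p)); [|now apply prv_impI].
    intros q Hq; now exists (form_code p).
Qed.

Lemma limit_imp p q : limit (Imp p q) <-> (limit p -> limit q).
Proof.
  split.
  - intros H Hp; apply (limit_closed2 _ _ _ H Hp).
    eapply prv_impE; apply prv_hyp; simpl; auto.
  - intros H; destruct (limit_dec p) as [Hp|Hp].
    + apply (limit_closed1 q); auto.
      apply prv_impI, prv_hyp; simpl; auto.
    + apply (limit_closed1 _ _ Hp), prv_impI, prv_raa.
      eapply prv_impE; apply prv_hyp; simpl; auto.
Qed.

Lemma limit_and p q : limit (And p q) <-> limit p /\ limit q.
Proof.
  split.
  - intros H; split; apply (limit_closed1 _ _ H);
      [eapply prv_andE1 | eapply prv_andE2]; apply prv_hyp; simpl; auto.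
  - intros [Hp Hq]; apply (limit_closed2 _ _ _ Hp Hq).
    apply prv_andI; apply prv_hyp; simpl; auto.
Qed.

Lemma limit_or p q : limit (Or p q) <-> limit p \/ limit q.
Proof.
  split.
  - intros H; destruct (limit_dec p) as [Hp|Hp]; auto.
    right; apply (limit_closed2 _ _ _ H Hp).
    eapply prv_orE; [apply prv_hyp; left; reflexivity| |];
      [apply prv_raa; eapply prv_impE|]; apply prv_hyp; simpl; auto.
  - intros [H|H]; apply (limit_closed1 _ _ H);
      [apply prv_orI1 | apply prv_orI2]; apply prv_hyp; simpl; auto.
Qed.

Lemma limit_ex p : limit (Ex p) <-> exists t, limit (inst t p).
Proof.
  split.
  - intros [n Hn].
    (* The variable that [add_witness] picked when [Ex p] was treated. *)
    exists (fresh (Ex p :: stage (form_code (Ex p)))).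
    exists (S (form_code (Ex p))).
    apply stage_add; [|simpl; auto].
    apply (stage_compatible n), prv_hyp, Hn.
  - intros [t Ht]; apply (limit_closed1 _ _ Ht), prv_exI with t, prv_hyp.
    simpl; auto.
Qed.

Lemma limit_all p : limit (All p) <-> forall t, limit (inst t p).
Proof.
  split.
  - intros H t; apply (limit_closed1 _ _ H), prv_allE, prv_hyp; simpl; auto.
  - intros H; destruct (limit_dec (All p)) as [|Hn]; auto.
    assert (He : limit (Ex (Imp p Bot))).
    { apply (limit_closed1 _ _ Hn), prv_not_all, prv_hyp; simpl; auto. }
    apply limit_ex in He; destruct He as [t Ht].
    destruct limit_bot.
    exact (proj1 (limit_imp _ _) Ht (H t)).
Qed.

Lemma limit_eq_refl i : limit (Eq i i).
Proof. apply (limit_closed []); [intros x [] | apply prv_eqI]. Qed.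

Lemma limit_eq_subst i j p :
  limit (Eq i j) -> limit (inst i p) -> limit (inst j p).
Proof.
  intros He Hp; apply (limit_closed2 _ _ _ He Hp).
  eapply prv_eqE; apply prv_hyp; simpl; auto.
Qed.

(** In the template formula index 0 is the hole; the other variable is raised by one because [inst]
    lowers it. *)
Lemma limit_eq_sym i j : limit (Eq i j) -> limit (Eq j i).
Proof.
  intros H; apply (limit_eq_subst i j (Eq 0 (S i)) H), limit_eq_refl.
Qed.

Lemma limit_eq_trans i j k : limit (Eq i j) -> limit (Eq j k) -> limit (Eq i k).
Proof. intros H H'; exact (limit_eq_subst j k (Eq (S i) 0) H' H). Qed.

Lemma limit_mem_eq i i' j j' :
  limit (Eq i i') -> limit (Eq j j') -> limit (Mem i j) -> limit (Mem i' j').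
Proof.
  intros Hi Hj H.
  apply (limit_eq_subst j j' (Mem (S i') 0) Hj).
  exact (limit_eq_subst i i' (Mem 0 (S j)) Hi H).
Qed.

(** * The term model and the truth lemma *)

Definition canon (i : nat) : nat := epsilon (inhabits 0) (fun j => limit (Eq i j)).

Lemma canon_spec i : limit (Eq i (canon i)).
Proof.
  exact (epsilon_spec (inhabits 0) (fun j => limit (Eq i j))
           (ex_intro _ i (limit_eq_refl i))).
Qed.

(** For provably equal variables the predicates given to [epsilon] coincide, hence so do the chosen
    values. The quotient can therefore be realized as the subtype of fixed points of [canon]. *)
Lemma canon_eq i j : canon i = canon j <-> limit (Eq i j).
Proof.
  split.
  - intros H; apply limit_eq_trans with (canon i); [apply canon_spec|].
    rewrite H; apply limit_eq_sym, canon_spec.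
  - intros H; unfold canon; f_equal.
    apply functional_extensionality; intros k; apply propositional_extensionality.
    split; intros Hk; [apply limit_eq_sym in H|]; eapply limit_eq_trans; eauto.
Qed.

Definition henkin_dom : Type := {i : nat | canon i = i}.

Lemma canonK i : canon (canon i) = canon i.
Proof. apply canon_eq, limit_eq_sym, canon_spec. Qed.

Definition class (i : nat) : henkin_dom := exist _ (canon i) (canonK i).

Definition henkin_mem (x y : henkin_dom) : Prop :=
  limit (Mem (proj1_sig x) (proj1_sig y)).

Lemma henkin_dom_eq (x y : henkin_dom) : proj1_sig x = proj1_sig y -> x = y.
Proof.
  destruct x as [i Hi], y as [j Hj]; simpl; intros <-.
  f_equal; apply UIP_dec, Nat.eq_dec.
Qed.

Lemma class_eq i j : class i = class j <-> limit (Eq i j).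
Proof.
  rewrite <- canon_eq; split.
  - exact (f_equal (fun x : henkin_dom => proj1_sig x) (x := class i) (y := class j)).
  - apply (henkin_dom_eq (class i) (class j)).
Qed.

Lemma class_surj (x : henkin_dom) : class (proj1_sig x) = x.
Proof.
  apply henkin_dom_eq; destruct x as [i Hi]; exact Hi.
Qed.

(** The statement quantifies over [r] so that, below a quantifier, the value of the bound variable
    becomes one more value of the renaming. *)
Lemma truth (p : form) (r : nat -> nat) :
  sat henkin_mem (fun i => class (r i)) p <-> limit (ren r p).
Proof.
  assert (Hs : forall x r p, sat henkin_mem (scons x (fun i => class (r i))) p <->
    sat henkin_mem (fun i => class (scons (proj1_sig x) r i)) p).
  { intros x s q; apply sat_ext; intros [|i]; simpl; auto.
    symmetry; apply class_surj. }
  revert r; induction p as [i j|i j| |p IHp q IHq|p IHp q IHq|p IHp q IHq|p IHp|p IHp];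
    intros r; simpl.
  - unfold henkin_mem; simpl; split; apply limit_mem_eq;
      try apply canon_spec; apply limit_eq_sym, canon_spec.
  - apply class_eq.
  - split; [tauto | apply limit_bot].
  - now rewrite limit_and, IHp, IHq.
  - now rewrite limit_or, IHp, IHq.
  - now rewrite limit_imp, IHp, IHq.
  - rewrite limit_all; split.
    + intros H t; rewrite inst_ren_up, <- IHp.
      specialize (H (class t)); revert H; apply sat_ext.
      intros [|i]; reflexivity.
    + intros H x; rewrite Hs, IHp, <- inst_ren_up; apply H.
  - rewrite limit_ex; split.
    + intros [x H]; exists (proj1_sig x).
      rewrite inst_ren_up, <- IHp; now apply Hs.
    + intros [t H]; exists (class t).
      rewrite inst_ren_up, <- IHp in H; revert H; apply sat_ext.
      intros [|i]; reflexivity.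
Qed.

(** Axioms may have free variables. Every valuation in the model comes from a renaming, and renamed
    axioms are still provable. *)
Lemma henkin_model (p : form) (v : nat -> henkin_dom) :
  T p -> sat henkin_mem v p.
Proof.
  intros Hp.
  apply (sat_ext _ _ (fun i => class (proj1_sig (v i))));
    [intros; apply class_surj|].
  apply truth, (limit_closed []); [intros x []|].
  apply prv_valid_ren; intros; now apply prv_ax.
Qed.

Lemma henkin_refutes : ~ sat henkin_mem class p0.
Proof.
  intros H.
  assert (Hp : limit p0) by (rewrite <- (ren_id p0); now apply truth).
  apply limit_bot; revert Hp; apply limit_imp.
  exists 0; simpl; auto.
Qed.

End Henkin.

Theorem completeness (T : form -> Prop) (p : form) :
  (forall (M : Type) (E : M -> M -> Prop),
     (forall q, T q -> forall v, sat E v q) -> forall v, sat E v p) ->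
  prv T [] p.
Proof.
  intros H; apply NNPP; intros Hp.
  apply (henkin_refutes T p Hp), H.
  intros q Hq v; now apply henkin_model.
Qed.

(** * Definable predicates in a model *)

(** These lemmas serve the tactic [definable]: each peels off one connective of a predicate and
    leaves the formula to unification. *)
Lemma sat_and {M} (E : M -> M -> Prop) v A B p q :
  (A <-> sat E v p) -> (B <-> sat E v q) -> (A /\ B <-> sat E v (And p q)).
Proof. simpl; tauto. Qed.

Lemma sat_or {M} (E : M -> M -> Prop) v A B p q :
  (A <-> sat E v p) -> (B <-> sat E v q) -> (A \/ B <-> sat E v (Or p q)).
Proof. simpl; tauto. Qed.

Lemma sat_imp {M} (E : M -> M -> Prop) v (A B : Prop) p q :
  (A <-> sat E v p) -> (B <-> sat E v q) -> ((A -> B) <-> sat E v (Imp p q)).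
Proof. simpl; tauto. Qed.

Lemma sat_all {M} (E : M -> M -> Prop) v (P : M -> Prop) p :
  (forall x, P x <-> sat E (scons x v) p) ->
  ((forall x, P x) <-> sat E v (All p)).
Proof. simpl; intros H; split; intros HP x; apply H, HP. Qed.

Lemma sat_ex {M} (E : M -> M -> Prop) v (P : M -> Prop) p :
  (forall x, P x <-> sat E (scons x v) p) ->
  ((exists x, P x) <-> sat E v (Ex p)).
Proof. simpl; intros H; split; intros [x HP]; exists x; apply H, HP. Qed.

Ltac var_index v t :=
  lazymatch v with
  | scons t _ => constr:(0)
  | scons _ ?w => let n := var_index w t in constr:(S n)
  end.

(* Solves [A <-> sat E v ?p] by reading off [?p] from [A], unfolding defined
   predicates; every free variable of [A] must occur in [v]. *)
Ltac definable :=
  lazymatch goal with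
  | |- _ /\ _ <-> _ => apply sat_and; definable
  | |- _ \/ _ <-> _ => apply sat_or; definable
  | |- False <-> sat ?E ?v _ => exact (iff_refl (sat E v Bot))
  | |- (exists x, _) <-> _ => apply sat_ex; intro; definable
  | |- ?a = ?b <-> sat ?E ?v _ =>
      let i := var_index v a in let j := var_index v b in
      exact (iff_refl (sat E v (Eq i j)))
  | |- ?E ?a ?b <-> sat ?E ?v _ =>
      let i := var_index v a in let j := var_index v b in
      exact (iff_refl (sat E v (Mem i j)))
  | |- (forall x : ?A, _) <-> _ =>
      lazymatch type of A with
      | Prop => apply sat_imp; definable
      | _ => apply sat_all; intro; definable
      end
  | |- ?A <-> ?B => let A' := eval red in A in change (A' <-> B); definable
  end.

(** Gathers every element of the model in the context into one valuation, so that all of them can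
    act as parameters of a defining formula; [v] is the default tail. *)
Ltac context_valuation M v :=
  match goal with
  | x : M |- _ =>
      lazymatch v with
      | context [x] => fail
      | _ => context_valuation M (scons x v)
      end
  | _ => v
  end.

Section Model.
Variable M : Type.
Variable E : M -> M -> Prop.
Hypothesis ZF_model : forall q, ZF q -> forall v, sat E v q.

Notation "x ∈ y" := (E x y) (at level 70, no associativity) : type_scope.

(** The predicates from here on copy the object-level notions clause by clause, so that satisfaction
    of the final formula is convertible with a statement about them. *)
Definition subsetM (a b : M) := forall z, z ∈ a -> z ∈ b.
Definition emptyM (a : M) := forall z, ~ z ∈ a.
Definition unionM (u a : M) := forall z, z ∈ u <-> exists y, y ∈ a /\ z ∈ y.
Definition inter2M (c a b : M) := forall z, z ∈ c <-> z ∈ a /\ z ∈ b.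
Definition diffM (c a b : M) := forall z, z ∈ c <-> z ∈ a /\ ~ z ∈ b.
Definition meetsM (a b : M) := exists z, z ∈ a /\ z ∈ b.
Definition succM (s n : M) := forall z, z ∈ s <-> z ∈ n \/ z = n.
Definition inductiveM (w : M) :=
  (exists e, emptyM e /\ e ∈ w) /\ (forall n, n ∈ w -> exists s, succM s n /\ s ∈ w).
Definition omegaM (w : M) :=
  inductiveM w /\ forall v, inductiveM v -> subsetM w v.
Definition pairM (p a b : M) := forall z, z ∈ p <-> z = a \/ z = b.
Definition opairM (p a b : M) :=
  exists u v, pairM u a a /\ pairM v a b /\ pairM p u v.
Definition mapsM (f x y : M) := exists p, opairM p x y /\ p ∈ f.
Definition bijectionM (f a b : M) :=
  (forall p, p ∈ f -> exists x y, x ∈ a /\ y ∈ b /\ opairM p x y) /\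
  (forall x, x ∈ a -> exists y, mapsM f x y /\ forall y', mapsM f x y' -> y' = y) /\
  (forall y, y ∈ b -> exists x, mapsM f x y /\ forall x', mapsM f x' y -> x' = x).
Definition equipotentM (a b : M) := exists f, bijectionM f a b.
Definition finiteM (a : M) :=
  exists w, omegaM w /\ exists n, n ∈ w /\ equipotentM a n.
Definition infiniteM (a : M) := ~ finiteM a.
Definition denumerableM (a : M) := exists w, omegaM w /\ equipotentM a w.

Definition topologyM (X T : M) :=
  (forall U, U ∈ T -> subsetM U X) /\
  (forall U, emptyM U -> U ∈ T) /\
  X ∈ T /\
  (forall S U, subsetM S T -> unionM U S -> U ∈ T) /\
  (forall U V W, U ∈ T -> V ∈ T -> inter2M W U V -> W ∈ T).
Definition clopenM (X T A : M) := A ∈ T /\ exists C, diffM C X A /\ C ∈ T.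
Definition neighborhoodM (X T N x : M) :=
  subsetM N X /\ exists U, U ∈ T /\ x ∈ U /\ subsetM U N.
Definition denseM (X T D : M) :=
  subsetM D X /\ forall U, U ∈ T -> (exists z, z ∈ U) -> meetsM U D.
Definition familyM (X F : M) := forall A, A ∈ F -> subsetM A X.
Definition locally_finiteM (X T F : M) :=
  familyM X F /\
  forall x, x ∈ X -> exists N, neighborhoodM X T N x /\
    exists G, (forall A, A ∈ G <-> A ∈ F /\ meetsM A N) /\ finiteM G.
Definition open_familyM (T F : M) := forall A, A ∈ F -> A ∈ T.
Definition clopen_familyM (X T F : M) := forall A, A ∈ F -> clopenM X T A.
Definition cellularM (T F : M) :=
  (forall A, A ∈ F -> A ∈ T /\ exists z, z ∈ A) /\
  (forall A B, A ∈ F -> B ∈ F -> ~ A = B -> ~ meetsM A B).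
Definition has_dense_unionM (X T F : M) :=
  exists D, unionM D F /\ denseM X T D.

(** * Elementary set theory in the model *)

Lemma extensionality (a b : M) : (forall z, z ∈ a <-> z ∈ b) -> a = b.
Proof. exact (ZF_model _ ZF_extensionality (fun _ => a) a b). Qed.

Lemma separation (P : M -> Prop) (v : nat -> M) (p : form) :
  (forall x, P x <-> sat E (scons x v) p) ->
  forall a, exists b, forall x, x ∈ b <-> x ∈ a /\ P x.
Proof.
  intros HP a; destruct (ZF_model _ (ZF_separation p) v a) as [b Hb].
  exists b; intros x; rewrite HP.
  (* In the axiom the schema formula stands below the binders of [a], [b] and [x], so parameter [k]
     has index [3 + k]. *)
  assert (Hr := sat_ren E p
    (fun i => match i with 0 => 0 | S k => 3 + k end)
    (scons x (scons b (scons a v))) (scons x v)).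
  rewrite <- Hr; [exact (Hb x)|].
  intros [|i]; reflexivity.
Qed.

Tactic Notation "separate" constr(a) "by" constr(P) "as" ident(b) ident(H) :=
  let v := context_valuation M (scons a (fun _ : nat => a)) in
  let Hex := fresh in
  assert (Hex : exists b, forall x, x ∈ b <-> x ∈ a /\ P x);
  [ eapply (separation P v); intro; cbv beta; definable
  | destruct Hex as [b H]; cbv beta in H ].

Lemma empty_exists (a : M) : exists e, emptyM e.
Proof.
  separate a by (fun _ : M => False) as e He.
  exists e; intros z Hz; now apply He in Hz.
Qed.

Lemma empty_unique e e' : emptyM e -> emptyM e' -> e = e'.
Proof.
  intros H H'; apply extensionality; intros z; split; intros Hz;
    [destruct (H _ Hz) | destruct (H' _ Hz)].
Qed.

Lemma empty_or_inhabited a : emptyM a \/ exists z, z ∈ a.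
Proof.
  destruct (classic (exists z, z ∈ a)) as [H|H]; auto.
  left; intros z Hz; eauto.
Qed.

Lemma pair_exists a b : exists p, pairM p a b.
Proof. exact (ZF_model _ ZF_pairing (fun _ => a) a b). Qed.

Lemma union_exists a : exists u, unionM u a.
Proof. exact (ZF_model _ ZF_union (fun _ => a) a). Qed.

Lemma powerset_exists a : exists p, forall z, z ∈ p <-> subsetM z a.
Proof. exact (ZF_model _ ZF_powerset (fun _ => a) a). Qed.

Lemma union2_exists a b : exists c, forall z, z ∈ c <-> z ∈ a \/ z ∈ b.
Proof.
  destruct (pair_exists a b) as [p Hp], (union_exists p) as [c Hc].
  exists c; intros z; rewrite (Hc z); split.
  - intros [y [Hy Hz]]; apply Hp in Hy; destruct Hy; subst; auto.
  - intros [H|H]; [exists a | exists b]; rewrite (Hp _); auto.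
Qed.

Lemma inter2_exists a b : exists c, inter2M c a b.
Proof. separate a by (fun x : M => x ∈ b) as c Hc; now exists c. Qed.

Lemma diff_exists a b : exists c, diffM c a b.
Proof. separate a by (fun x : M => ~ x ∈ b) as c Hc; now exists c. Qed.

Lemma adjoin_exists a x : exists b, forall z, z ∈ b <-> z ∈ a \/ z = x.
Proof.
  destruct (pair_exists x x) as [p Hp], (union2_exists a p) as [c Hc].
  exists c; intros z; rewrite (Hc z), (Hp z); tauto.
Qed.

Lemma succ_exists n : exists s, succM s n.
Proof. apply adjoin_exists. Qed.

Lemma succ_unique s s' n : succM s n -> succM s' n -> s = s'.
Proof.
  intros H H'; apply extensionality; intros z; now rewrite (H z), (H' z).
Qed.

Lemma opair_exists a b : exists p, opairM p a b.
Proof.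
  destruct (pair_exists a a) as [u Hu], (pair_exists a b) as [v Hv],
    (pair_exists u v) as [p Hp].
  exists p, u, v; auto.
Qed.

Lemma pair_unique p q a b : pairM p a b -> pairM q a b -> p = q.
Proof.
  intros H H'; apply extensionality; intros z; now rewrite (H z), (H' z).
Qed.

Lemma pair_inj p a b a' b' :
  pairM p a b -> pairM p a' b' -> (a = a' /\ b = b') \/ (a = b' /\ b = a').
Proof.
  intros H H'.
  assert (Ha := proj2 (H a) (or_introl eq_refl)).
  assert (Hb := proj2 (H b) (or_intror eq_refl)).
  assert (Ha' := proj2 (H' a') (or_introl eq_refl)).
  assert (Hb' := proj2 (H' b') (or_intror eq_refl)).
  apply H' in Ha, Hb; apply H in Ha', Hb'; intuition congruence.
Qed.

Lemma opair_unique p q a b : opairM p a b -> opairM q a b -> p = q.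
Proof.
  intros [u [v [Hu [Hv Hp]]]] [u' [v' [Hu' [Hv' Hq]]]].
  rewrite (pair_unique _ _ _ _ Hu' Hu), (pair_unique _ _ _ _ Hv' Hv) in Hq.
  exact (pair_unique _ _ _ _ Hp Hq).
Qed.

Lemma opair_inj p a b a' b' : opairM p a b -> opairM p a' b' -> a = a' /\ b = b'.
Proof.
  intros [u [v [Hu [Hv Hp]]]] [u' [v' [Hu' [Hv' Hp']]]].
  destruct (pair_inj _ _ _ _ _ Hp Hp') as [[<- <-]|[<- <-]].
  - destruct (pair_inj _ _ _ _ _ Hu Hu'), (pair_inj _ _ _ _ _ Hv Hv');
      intuition congruence.
  - destruct (pair_inj _ _ _ _ _ Hu Hv'), (pair_inj _ _ _ _ _ Hv Hu');
      intuition congruence.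
Qed.

Lemma maps_opair f p a b : opairM p a b -> mapsM f a b <-> p ∈ f.
Proof.
  intros Hp; split.
  - intros [q [Hq Hf]]; now rewrite (opair_unique _ _ _ _ Hp Hq).
  - intros H; now exists p.
Qed.

Lemma product_exists a b :
  exists P, forall p, p ∈ P <-> exists x y, x ∈ a /\ y ∈ b /\ opairM p x y.
Proof.
  destruct (union2_exists a b) as [c Hc], (powerset_exists c) as [d Hd],
    (powerset_exists d) as [e He].
  separate e by (fun p : M => exists x y, x ∈ a /\ y ∈ b /\ opairM p x y) as P HP.
  exists P; intros p; rewrite (HP p); split; [tauto|]; intros H; split; auto.
  destruct H as [x [y [Hx [Hy [u [v [Hu [Hv Hp]]]]]]]].
  apply He; intros z Hz; apply Hd; intros t Ht; apply Hc.
  apply Hp in Hz; destruct Hz; subst z;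
    [apply Hu in Ht | apply Hv in Ht]; destruct Ht; subst; auto.
Qed.

(** * Natural numbers *)

Lemma omega_exists (a : M) : exists w, omegaM w.
Proof.
  destruct (ZF_model _ ZF_infinity (fun _ => a)) as [i Hi].
  change (inductiveM i) in Hi.
  separate i by (fun n : M => forall v, inductiveM v -> n ∈ v) as w Hw.
  exists w; split; [split|].
  - destruct (empty_exists a) as [e He]; exists e; split; auto.
    assert (H : forall v, inductiveM v -> e ∈ v).
    { intros v [[e' [He' Hv]] _]; now rewrite (empty_unique _ _ He He'). }
    apply Hw; auto.
  - intros n Hn; apply Hw in Hn; destruct (succ_exists n) as [s Hs].
    exists s; split; auto.
    assert (H : forall v, inductiveM v -> s ∈ v).
    { intros v Hv; destruct (proj2 Hv n) as [s' [Hs' H']]; [now apply Hn|].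
      now rewrite (succ_unique _ _ _ Hs Hs'). }
    apply Hw; auto.
  - intros v Hv n Hn; apply Hw in Hn; now apply Hn.
Qed.

Variable w : M.
Hypothesis Hw : omegaM w.

Lemma omega_unique w' : omegaM w' -> w' = w.
Proof.
  intros H; apply extensionality; intros z; split;
    [apply (proj2 H) | apply (proj2 Hw)]; [apply Hw | apply H].
Qed.

Lemma omega_empty e : emptyM e -> e ∈ w.
Proof.
  intros He; destruct Hw as [[[e' [He' H]] _] _].
  now rewrite (empty_unique _ _ He He').
Qed.

Lemma omega_succ n s : n ∈ w -> succM s n -> s ∈ w.
Proof.
  intros Hn Hs; destruct Hw as [[_ H] _]; destruct (H n Hn) as [s' [Hs' H']].
  now rewrite (succ_unique _ _ _ Hs Hs').
Qed.

(** The model may contain nonstandard numbers, so induction is restricted to definable predicates,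
    for which Separation yields an inductive subset of [w]. *)
Lemma omega_ind (P : M -> Prop) (v : nat -> M) (p : form) :
  (forall x, P x <-> sat E (scons x v) p) ->
  (forall e, emptyM e -> P e) ->
  (forall n s, n ∈ w -> P n -> succM s n -> P s) ->
  forall n, n ∈ w -> P n.
Proof.
  intros HP H0 HS n Hn.
  destruct (separation P v p HP w) as [i Hi].
  apply Hi; revert n Hn; apply (proj2 Hw); split.
  - destruct (empty_exists w) as [e He]; exists e; split; auto.
    apply Hi; split; [now apply omega_empty | auto].
  - intros n Hn; apply Hi in Hn; destruct (succ_exists n) as [s Hs].
    exists s; split; auto.
    apply Hi; split; [eapply omega_succ | eapply HS]; eauto; tauto.
Qed.

Ltac by_omega_ind :=
  let val := context_valuation M (scons w (fun _ : nat => w)) in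
  refine (omega_ind _ val _ _ _ _); [intro; cbv beta; definable | |].

Lemma mem_succ s n : succM s n -> n ∈ s.
Proof. intros H; apply H; auto. Qed.

Lemma succ_not_empty s n : succM s n -> ~ emptyM s.
Proof. intros H He; apply (He n), mem_succ, H. Qed.

Lemma omega_mem_trans n m k : n ∈ w -> m ∈ n -> k ∈ m -> k ∈ n.
Proof.
  intros Hn; revert m k; revert n Hn; by_omega_ind.
  - intros e He m k Hm; destruct (He _ Hm).
  - intros n s Hn IH Hs m k Hm Hk; apply Hs; left.
    apply Hs in Hm; destruct Hm; subst; eauto.
Qed.

Lemma omega_irrefl n : n ∈ w -> ~ n ∈ n.
Proof.
  revert n; by_omega_ind.
  - intros e He; apply He.
  - intros n s Hn IH Hs H; apply IH.
    assert (Hns := mem_succ _ _ Hs).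
    apply Hs in H; destruct H as [H|H].
    + eapply omega_mem_trans; eauto.
    + congruence.
Qed.

Lemma omega_zero_le e n : emptyM e -> n ∈ w -> e = n \/ e ∈ n.
Proof.
  intros He; revert n; by_omega_ind.
  - intros e' He'; left; now apply empty_unique.
  - intros n s Hn IH Hs; right; apply Hs; destruct IH; auto.
Qed.

Lemma omega_succ_le m s n : n ∈ w -> succM s m -> m ∈ n -> s = n \/ s ∈ n.
Proof.
  intros Hn Hs; revert n Hn; by_omega_ind.
  - intros e He H; destruct (He _ H).
  - intros n t Hn IH Ht Hm; apply Ht in Hm; destruct Hm as [Hm|Hm].
    + right; apply Ht; destruct (IH Hm); auto.
    + left; subst; eapply succ_unique; eauto.
Qed.

Lemma omega_linear n m : n ∈ w -> m ∈ w -> n ∈ m \/ n = m \/ m ∈ n.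
Proof.
  intros Hn Hm; revert n Hn; by_omega_ind.
  - intros e He; destruct (omega_zero_le e m); auto.
  - intros n s Hn IH Hs; destruct IH as [IH|[IH|IH]].
    + destruct (omega_succ_le n s m); auto.
    + right; right; apply Hs; auto.
    + right; right; apply Hs; auto.
Qed.

(** * Finite sets *)

Lemma finite_omega a : finiteM a <-> exists n, n ∈ w /\ equipotentM a n.
Proof.
  split.
  - intros [w' [Hw' H]]; now rewrite (omega_unique _ Hw') in H.
  - intros H; now exists w.
Qed.

Lemma finite_empty a : emptyM a -> finiteM a.
Proof.
  intros Ha; apply finite_omega; exists a; split; [now apply omega_empty|].
  exists a; repeat split.
  - intros p Hp; destruct (Ha _ Hp).
  - intros p Hp; destruct (Ha _ Hp).
  - intros p Hp; destruct (Ha _ Hp).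
Qed.

Lemma bijection_mem f a b x y : bijectionM f a b -> mapsM f x y -> x ∈ a /\ y ∈ b.
Proof.
  intros [H _] [p [Hp Hf]]; destruct (H p Hf) as [x' [y' [Hx [Hy Hp']]]].
  destruct (opair_inj _ _ _ _ _ Hp Hp'); subst; auto.
Qed.

Lemma bijection_fun f a b x y y' :
  bijectionM f a b -> mapsM f x y -> mapsM f x y' -> y = y'.
Proof.
  intros H Hy Hy'; assert (Hx := bijection_mem _ _ _ _ _ H Hy).
  destruct H as [_ [H _]]; destruct (H x) as [z [_ Hz]]; [tauto|].
  rewrite (Hz _ Hy), (Hz _ Hy'); auto.
Qed.

Lemma bijection_inj f a b x x' y :
  bijectionM f a b -> mapsM f x y -> mapsM f x' y -> x = x'.
Proof.
  intros H Hy Hy'; assert (Hx := bijection_mem _ _ _ _ _ H Hy).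
  destruct H as [_ [_ H]]; destruct (H y) as [z [_ Hz]]; [tauto|].
  rewrite (Hz _ Hy), (Hz _ Hy'); auto.
Qed.

Lemma bijection_intro f a b :
  (forall p, p ∈ f -> exists x y, x ∈ a /\ y ∈ b /\ opairM p x y) ->
  (forall x, x ∈ a -> exists y, mapsM f x y) ->
  (forall y, y ∈ b -> exists x, mapsM f x y) ->
  (forall x y y', mapsM f x y -> mapsM f x y' -> y = y') ->
  (forall x x' y, mapsM f x y -> mapsM f x' y -> x = x') ->
  bijectionM f a b.
Proof.
  intros H H1 H2 H3 H4; split; [exact H|split].
  - intros x Hx; destruct (H1 x Hx) as [y Hy]; exists y; eauto.
  - intros y Hy; destruct (H2 y Hy) as [x Hx]; exists x; eauto.
Qed.

Lemma finite_adjoin a b x :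
  finiteM a -> (forall z, z ∈ b <-> z ∈ a \/ z = x) -> finiteM b.
Proof.
  intros Ha Hb; destruct (classic (x ∈ a)) as [Hx|Hx].
  { replace b with a; auto; apply extensionality; intros z; rewrite (Hb z).
    split; auto; intros [H|H]; subst; auto. }
  apply finite_omega in Ha; destruct Ha as [n [Hn [f Hf]]].
  apply finite_omega.
  destruct (succ_exists n) as [s Hs]; exists s.
  split; [eapply omega_succ; eauto|].
  destruct (opair_exists x n) as [q Hq], (adjoin_exists f q) as [g Hg].
  assert (Hm : forall y k, mapsM g y k <-> mapsM f y k \/ (y = x /\ k = n)).
  { intros y k; split.
    - intros [p [Hp H]]; apply Hg in H; destruct H as [H|H].
      + left; now exists p.
      + subst p; right; eapply opair_inj; eauto.
    - intros [[p [Hp H]]|[-> ->]].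
      + exists p; split; auto; apply Hg; auto.
      + exists q; split; auto; apply Hg; auto. }
  exists g; apply bijection_intro.
  - intros p Hp; apply Hg in Hp; destruct Hp as [Hp|Hp].
    + destruct (proj1 Hf p Hp) as [y [k [Hy [Hk Hpk]]]].
      exists y, k; rewrite (Hb y), (Hs k); auto.
    + subst p; exists x, n; rewrite (Hb x), (Hs n); auto.
  - intros y Hy; apply Hb in Hy; destruct Hy as [Hy|Hy].
    + destruct (proj1 (proj2 Hf) y Hy) as [k [Hk _]].
      exists k; apply Hm; auto.
    + exists n; apply Hm; auto.
  - intros k Hk; apply Hs in Hk; destruct Hk as [Hk|Hk].
    + destruct (proj2 (proj2 Hf) k Hk) as [y [Hy _]].
      exists y; apply Hm; auto.
    + exists x; apply Hm; auto.
  - intros y k k' H H'; apply Hm in H, H'.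
    destruct H as [H|[Hy Hk]], H' as [H'|[Hy' Hk']].
    + eapply bijection_fun; eauto.
    + subst; apply (bijection_mem _ _ _ _ _ Hf) in H; tauto.
    + subst; apply (bijection_mem _ _ _ _ _ Hf) in H'; tauto.
    + congruence.
  - intros y y' k H H'; apply Hm in H, H'.
    assert (Hnn := omega_irrefl n Hn).
    destruct H as [H|[Hy Hk]], H' as [H'|[Hy' Hk']].
    + eapply bijection_inj; eauto.
    + subst; apply (bijection_mem _ _ _ _ _ Hf) in H; tauto.
    + subst; apply (bijection_mem _ _ _ _ _ Hf) in H'; tauto.
    + congruence.
Qed.

(** Induction on the cardinality: from a set of size [n + 1] the element paired with the last number
    [n] is removed. *)
Lemma finite_ind (P : M -> Prop) (v : nat -> M) (p : form) :
  (forall x, P x <-> sat E (scons x v) p) ->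
  (forall e, emptyM e -> P e) ->
  (forall a b x, P a -> (forall z, z ∈ b <-> z ∈ a \/ z = x) -> P b) ->
  forall a, finiteM a -> P a.
Proof.
  intros HP H0 HS a Ha; apply finite_omega in Ha; destruct Ha as [n [Hn Ha]].
  revert a Ha; revert n Hn.
  refine (omega_ind _ v _ _ _ _).
  (* Here index 0 is [a] and index 1 is [n]; the renaming lets [p] skip [n]. *)
  { intros n; apply sat_all; intros a; apply sat_imp; [definable|].
    rewrite HP; symmetry.
    apply (sat_ren E p (fun i => match i with 0 => 0 | S k => S (S k) end)).
    intros [|i]; reflexivity. }
  - intros e He a [f Hf]; apply H0; intros x Hx.
    destruct (proj1 (proj2 Hf) x Hx) as [y [Hy _]].
    apply (bijection_mem _ _ _ _ _ Hf) in Hy; apply (He y); tauto.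
  - intros n s Hn IH Hs b [f Hf].
    destruct (proj2 (proj2 Hf) n (mem_succ _ _ Hs)) as [x [Hx _]].
    assert (Hxb := proj1 (bijection_mem _ _ _ _ _ Hf Hx)).
    separate b by (fun z : M => ~ z = x) as a Ha.
    assert (Hab : forall z, z ∈ b <-> z ∈ a \/ z = x).
    { intros z; rewrite (Ha z); destruct (classic (z = x)); subst; tauto. }
    apply HS with a x; [apply IH | exact Hab].
    separate f by (fun p : M => ~ opairM p x n) as g Hg.
    assert (Hm : forall y k, mapsM g y k <-> mapsM f y k /\ ~ y = x).
    { intros y k; split.
      - intros [q [Hq H]]; apply Hg in H; destruct H as [H Hn'].
        assert (Hyk : mapsM f y k) by now exists q.
        split; auto.
        intros ->; rewrite (bijection_fun _ _ _ _ _ _ Hf Hyk Hx) in Hq; auto.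
      - intros [[q [Hq H]] Hy]; exists q; split; auto.
        apply Hg; split; auto.
        intros Hq'; apply Hy; now apply (opair_inj _ _ _ _ _ Hq Hq'). }
    exists g; apply bijection_intro.
    + intros q Hq; assert (Hqf := proj1 (proj1 (Hg q) Hq)).
      destruct (proj1 Hf q Hqf) as [y [k [Hy [Hk Hqk]]]].
      assert (Hyk : mapsM g y k) by now exists q.
      apply Hm in Hyk; destruct Hyk as [Hyk Hyx].
      exists y, k; repeat split; auto.
      * apply Ha; auto.
      * apply Hs in Hk; destruct Hk as [Hk| ->]; auto.
        destruct Hyx; eapply bijection_inj; eauto.
    + intros y Hy; apply Ha in Hy; destruct Hy as [Hy Hyx].
      destruct (proj1 (proj2 Hf) y Hy) as [k [Hk _]].
      exists k; apply Hm; auto.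
    + intros k Hk; destruct (proj2 (proj2 Hf) k) as [y [Hy _]];
        [apply Hs; auto|].
      exists y; apply Hm; split; auto.
      intros ->; rewrite (bijection_fun _ _ _ _ _ _ Hf Hy Hx) in Hk.
      exact (omega_irrefl n Hn Hk).
    + intros y k k' H H'; apply Hm in H, H'.
      eapply bijection_fun; [exact Hf | apply H | apply H'].
    + intros y y' k H H'; apply Hm in H, H'.
      eapply bijection_inj; [exact Hf | apply H | apply H'].
Qed.

Ltac by_finite_ind :=
  let val := context_valuation M (scons w (fun _ : nat => w)) in
  refine (finite_ind _ val _ _ _ _); [intro; cbv beta; definable | |].

Lemma finite_subset a b : finiteM a -> subsetM b a -> finiteM b.
Proof.
  intros Ha; revert b; revert a Ha; by_finite_ind.
  - intros e He b Hb; apply finite_empty; intros z Hz; apply (He z), Hb, Hz.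
  - intros a a' x IH Ha' b Hb.
    separate b by (fun z : M => ~ z = x) as c Hc.
    assert (Hcf : finiteM c).
    { apply IH; intros z Hz; apply Hc in Hz; destruct Hz as [Hz Hzx].
      apply Hb, Ha' in Hz; tauto. }
    destruct (classic (x ∈ b)) as [Hx|Hx].
    + apply (finite_adjoin c b x Hcf); intros z; rewrite (Hc z).
      destruct (classic (z = x)); subst; tauto.
    + replace b with c; auto; apply extensionality; intros z; rewrite (Hc z).
      destruct (classic (z = x)); subst; tauto.
Qed.

Lemma finite_union2 a b c :
  finiteM a -> finiteM b -> (forall z, z ∈ c <-> z ∈ a \/ z ∈ b) -> finiteM c.
Proof.
  intros Ha Hb; revert c; revert a Ha; by_finite_ind.
  - intros e He c Hc; replace c with b; auto.
    apply extensionality; intros z; rewrite (Hc z); specialize (He z); tauto.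
  - intros a a' x IH Ha' c Hc.
    destruct (union2_exists a b) as [d Hd].
    apply (finite_adjoin d c x (IH d Hd)).
    intros z; rewrite (Hc z), (Hd z), (Ha' z); tauto.
Qed.

(** * Unbounded sets of natural numbers are denumerable *)

(** The recursion step of a counting function: if [k] elements of [S] lie below [n], then [j] of
    them lie below the successor of [n]. *)
Definition count_step (S n k j : M) := (n ∈ S /\ succM j k) \/ (~ n ∈ S /\ j = k).

Definition count_closed (S R : M) :=
  (exists e, emptyM e /\ mapsM R e e) /\
  (forall n s k j, n ∈ w -> k ∈ w -> succM s n -> count_step S n k j ->
     mapsM R n k -> mapsM R s j).

Lemma count_step_exists S n k : k ∈ w -> exists j, j ∈ w /\ count_step S n k j.
Proof.
  intros Hk; destruct (classic (n ∈ S)) as [H|H].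
  - destruct (succ_exists k) as [j Hj]; exists j; split;
      [eapply omega_succ; eauto | left; auto].
  - exists k; split; auto; right; auto.
Qed.

Lemma count_step_unique S n k j j' :
  count_step S n k j -> count_step S n k j' -> j = j'.
Proof.
  intros [[H Hj]|[H Hj]] [[H' Hj']|[H' Hj']]; try tauto; try congruence.
  eapply succ_unique; eauto.
Qed.

(* [C] is the graph of the recursively defined function taking [n] to the
   number of elements of [S] below [n]. *)
Lemma count_exists S :
  exists C,
    (forall p, p ∈ C -> exists n k, n ∈ w /\ k ∈ w /\ opairM p n k) /\
    count_closed S C /\
    (forall e k, emptyM e -> mapsM C e k -> emptyM k) /\
    (forall n s j, n ∈ w -> succM s n -> mapsM C s j ->
       exists k, mapsM C n k /\ count_step S n k j).
Proof.
  destruct (product_exists w w) as [W HW].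
  separate W by (fun p : M => forall R, count_closed S R -> p ∈ R) as C HC.
  assert (HCw : forall p, p ∈ C -> exists n k, n ∈ w /\ k ∈ w /\ opairM p n k).
  { intros p Hp; apply HC in Hp; now apply HW. }
  assert (HCc : count_closed S C).
  { split.
    - destruct (empty_exists w) as [e He]; exists e; split; auto.
      destruct (opair_exists e e) as [p Hp]; exists p; split; auto.
      apply HC; split.
      + apply HW; exists e, e; auto using omega_empty.
      + intros R [[e' [He' HR]] _].
        rewrite (empty_unique _ _ He' He) in HR.
        now apply (maps_opair _ _ _ _ Hp).
    - intros n s k j Hn Hk Hs Hj HCnk.
      destruct (opair_exists s j) as [p Hp]; exists p; split; auto.
      apply HC; split.
      + apply HW; exists s, j; split; [exact (omega_succ _ _ Hn Hs)|split; auto].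
        destruct (count_step_exists S n k Hk) as [j' [Hj'w Hj']].
        now rewrite (count_step_unique _ _ _ _ _ Hj Hj').
      + intros R HR; apply (maps_opair _ _ _ _ Hp).
        apply (proj2 HR n s k j); auto.
        destruct HCnk as [q [Hq H]]; exists q; split; auto.
        now apply HC. }
  (* Inversion by minimality: the pairs of [C] that arise from one of the two clauses already form a
     closed relation [R], so all pairs of [C] lie in [R]. *)
  assert (Hinv : forall n k, mapsM C n k ->
    (emptyM n /\ emptyM k) \/
    exists m i, m ∈ w /\ succM n m /\ mapsM C m i /\ count_step S m i k).
  { separate C by (fun p : M => exists n k, opairM p n k /\
      ((emptyM n /\ emptyM k) \/
       exists m i, m ∈ w /\ succM n m /\ mapsM C m i /\ count_step S m i k)) as R HR.
    intros n k [p [Hp H]].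
    assert (HRc : count_closed S R).
    { split.
      - destruct HCc as [[e [He [q [Hq HqC]]]] _].
        exists e; split; auto; exists q; split; auto.
        apply HR; split; auto; exists e, e; auto.
      - intros n' s k' j Hn' Hk' Hs Hj [q [Hq HqR]].
        assert (Hm : mapsM C n' k') by (exists q; split; auto; now apply HR).
        destruct (proj2 HCc n' s k' j Hn' Hk' Hs Hj Hm) as [q' [Hq' HqC]].
        exists q'; split; auto; apply HR; split; auto.
        exists s, j; split; auto; right; exists n', k'; auto. }
    assert (HpR : p ∈ R) by (apply HC in H; now apply H).
    apply HR in HpR; destruct HpR as [_ [n' [k' [Hp' H']]]].
    now destruct (opair_inj _ _ _ _ _ Hp Hp') as [<- <-]. }
  exists C; repeat split; auto; try apply HCc.
  - intros e k He H; destruct (Hinv e k H) as [?|[m [i [_ [Hs _]]]]]; [tauto|].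
    destruct (succ_not_empty _ _ Hs He).
  - intros n s j Hn Hs H.
    destruct (Hinv s j H) as [[He _]|[m [i [Hm [Hs' [HC' Hst]]]]]].
    + destruct (succ_not_empty _ _ Hs He).
    + assert (m = n) as ->; [|eauto].
      assert (H1 := mem_succ _ _ Hs); assert (H2 := mem_succ _ _ Hs').
      apply Hs' in H1; apply Hs in H2.
      destruct H1 as [H1|]; auto; destruct H2 as [H2|]; auto.
      destruct (omega_irrefl n Hn).
      exact (omega_mem_trans _ _ _ Hn H2 H1).
Qed.

(** The counting function restricted to [S] is the bijection. It is injective since the count grows
    strictly past each element of [S], and onto since the count grows by at most one, only at
    elements of [S], and without bound. *)
Lemma unbounded_denumerable S :
  subsetM S w ->
  (forall k, k ∈ w -> exists n, n ∈ S /\ (n = k \/ k ∈ n)) ->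
  equipotentM S w.
Proof.
  intros HS Hunb.
  destruct (count_exists S) as [C [HCw [[HC0 HCS] [Hinv0 HinvS]]]].
  assert (Hw' : forall n k, mapsM C n k -> n ∈ w /\ k ∈ w).
  { intros n k [p [Hp H]]; destruct (HCw p H) as [n' [k' [Hn [Hk Hp']]]].
    destruct (opair_inj _ _ _ _ _ Hp Hp'); subst; auto. }
  assert (Htot : forall n, n ∈ w -> exists k, mapsM C n k).
  { by_omega_ind.
    - intros e He; destruct HC0 as [e' [He' H]]; exists e'.
      now rewrite (empty_unique _ _ He He').
    - intros n s Hn [k Hk] Hs.
      destruct (Hw' _ _ Hk) as [_ Hkw].
      destruct (count_step_exists S n k Hkw) as [j [_ Hj]].
      exists j; exact (HCS n s k j Hn Hkw Hs Hj Hk). }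
  assert (Hfun : forall n, n ∈ w -> forall k k', mapsM C n k -> mapsM C n k' -> k = k').
  { by_omega_ind.
    - intros e He k k' H H'; apply empty_unique; eauto.
    - intros n s Hn IH Hs j j' H H'.
      destruct (HinvS _ _ _ Hn Hs H) as [k [Hk Hj]].
      destruct (HinvS _ _ _ Hn Hs H') as [k' [Hk' Hj']].
      rewrite <- (IH _ _ Hk Hk') in Hj'; eapply count_step_unique; eauto. }
  assert (Hmono : forall m, m ∈ w -> forall n k j, n ∈ m -> mapsM C n k -> mapsM C m j ->
    (k = j \/ k ∈ j) /\ (n ∈ S -> k ∈ j)).
  { by_omega_ind.
    - intros e He n k j Hn; destruct (He _ Hn).
    - intros m s Hm IH Hs n k j Hn Hk Hj.
      destruct (HinvS _ _ _ Hm Hs Hj) as [i [Hi Hst]].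
      apply Hs in Hn; destruct Hn as [Hn| ->].
      + destruct (IH n k i Hn Hk Hi) as [Hle Hlt].
        destruct Hst as [[HmS Hij]|[_ ->]]; auto.
        assert (k ∈ j) by (apply Hij; tauto); auto.
      + rewrite (Hfun _ Hm _ _ Hi Hk) in Hst.
        destruct Hst as [[HmS Hij]|[HmS ->]]; [|tauto].
        apply mem_succ in Hij; auto. }
  assert (Hhit : forall m, m ∈ w -> forall j, mapsM C m j -> forall i, i ∈ j ->
    exists n, n ∈ S /\ mapsM C n i).
  { by_omega_ind.
    - intros e He j Hj i Hi; destruct (Hinv0 _ _ He Hj _ Hi).
    - intros m s Hm IH Hs j Hj i Hi.
      destruct (HinvS _ _ _ Hm Hs Hj) as [k [Hk [[HmS Hkj]|[HmS ->]]]]; [|eauto].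
      apply Hkj in Hi; destruct Hi as [Hi| ->]; eauto. }
  assert (Hbig : forall k, k ∈ w -> exists m j, mapsM C m j /\ k ∈ j).
  { assert (Hnext : forall n i, n ∈ S -> mapsM C n i ->
      exists s j, succM j i /\ mapsM C s j).
    { intros n i Hn Hi.
      destruct (succ_exists n) as [s Hs], (succ_exists i) as [j Hj].
      exists s, j; split; auto.
      destruct (Hw' _ _ Hi) as [Hnw Hiw].
      apply (HCS n s i j Hnw Hiw Hs); auto; left; auto. }
    by_omega_ind.
    - intros e He; destruct (Hunb e (omega_empty e He)) as [n [Hn _]].
      destruct (Htot n (HS n Hn)) as [i Hi].
      destruct (Hnext n i Hn Hi) as [s [j [Hj Hsj]]].
      exists s, j; split; auto; apply Hj.
      destruct (Hw' _ _ Hi) as [_ Hiw].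
      destruct (omega_zero_le e i He Hiw); auto.
    (* An element of [S] at or above [m] still has a count above [k], and passing it raises the
       count once more, above [t]. *)
    - intros k t Hk [m [j [Hmj Hkj]]] Ht.
      destruct (Hw' _ _ Hmj) as [Hm Hj].
      destruct (Hunb m Hm) as [n [Hn Hmn]].
      destruct (Htot n (HS n Hn)) as [i Hi].
      destruct (Hw' _ _ Hi) as [Hnw Hiw].
      destruct (Hnext n i Hn Hi) as [s [j' [Hj' Hsj]]].
      exists s, j'; split; auto; apply Hj'.
      assert (Hki : k ∈ i).
      { destruct Hmn as [-> |Hmn].
        - now rewrite (Hfun _ Hm _ _ Hi Hmj).
        - destruct (Hmono n Hnw m j i Hmn Hmj Hi) as [[<- |Hji] _]; auto.
          exact (omega_mem_trans i j k Hiw Hji Hkj). }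
      destruct (omega_succ_le k t i Hiw Ht Hki); auto. }
  separate C by (fun p : M => exists n k, opairM p n k /\ n ∈ S) as g Hg.
  assert (Hm : forall n k, mapsM g n k <-> mapsM C n k /\ n ∈ S).
  { intros n k; split.
    - intros [p [Hp H]]; apply Hg in H; destruct H as [H [n' [k' [Hp' Hn]]]].
      destruct (opair_inj _ _ _ _ _ Hp Hp') as [-> ->]; split; auto.
      now exists p.
    - intros [[p [Hp H]] Hn]; exists p; split; auto.
      apply Hg; split; auto; exists n, k; auto. }
  exists g; apply bijection_intro.
  - intros p Hp; apply Hg in Hp; destruct Hp as [Hp [n [k [Hpk Hn]]]].
    exists n, k; repeat split; auto.
    apply (Hw' n); now exists p.
  - intros n Hn; destruct (Htot n (HS n Hn)) as [k Hk]; exists k; apply Hm; auto.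
  - intros k Hk; destruct (Hbig k Hk) as [m [j [Hmj Hkj]]].
    destruct (Hw' _ _ Hmj) as [Hmw _].
    destruct (Hhit m Hmw j Hmj k Hkj) as [n [Hn Hnk]].
    exists n; apply Hm; auto.
  - intros n k k' H H'; apply Hm in H, H'.
    apply (Hfun n); [apply (Hw' n k)| |]; tauto.
  - intros n n' k H H'; apply Hm in H, H'.
    destruct H as [H Hn], H' as [H' Hn'].
    destruct (Hw' _ _ H) as [Hnw Hkw], (Hw' _ _ H') as [Hnw' _].
    destruct (omega_linear n n' Hnw Hnw') as [Hlt|[Heq|Hlt]]; auto;
      destruct (omega_irrefl k Hkw).
    + now apply (Hmono n' Hnw' n k k).
    + now apply (Hmono n Hnw n' k k).
Qed.

(** * Open sets *)

(** [D] is the union of all its open subsets; using all of them avoids choosing a neighborhood for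
    each point. *)
Lemma open_of_local X T D :
  topologyM X T ->
  (forall z, z ∈ D -> exists V, V ∈ T /\ z ∈ V /\ subsetM V D) -> D ∈ T.
Proof.
  intros [_ [_ [_ [HU _]]]] H.
  separate T by (fun V : M => subsetM V D) as S HS.
  apply (HU S D).
  - intros V HV; now apply HS.
  - intros z; split.
    + intros Hz; destruct (H z Hz) as [V [HV [HzV HVD]]].
      exists V; split; auto; apply HS; auto.
    + intros [V [HV HzV]]; apply HS in HV; now apply HV.
Qed.

Lemma open_inter X T U V :
  topologyM X T -> U ∈ T -> V ∈ T -> exists W, W ∈ T /\ inter2M W U V.
Proof.
  intros [_ [_ [_ [_ HI]]]] HU HV; destruct (inter2_exists U V) as [W HW].
  exists W; eauto.
Qed.

(** * Denumerable locally finite families *)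

Section Enumerated.
Variables X T F f : M.
Hypothesis HT : topologyM X T.
Hypothesis Hf : bijectionM f F w.
Hypothesis HF : locally_finiteM X T F.
Hypothesis Fopen : open_familyM T F.

(* [member n] is the [n]-th set of the enumeration, except that [member 0] is
   replaced by [X]; this makes the union of the cells below dense. *)
Definition member (n z : M) := z ∈ X /\ (emptyM n \/ exists A, mapsM f A n /\ z ∈ A).

(** Membership of [z] in the complement of the closure of the union of all members with index above
    [n]. *)
Definition off_tail (n z : M) :=
  exists U, U ∈ T /\ z ∈ U /\ forall A m, mapsM f A m -> n ∈ m -> ~ meetsM A U.

Definition in_cell (n z : M) := member n z /\ off_tail n z.
Definition cell (n D : M) := forall z, z ∈ D <-> in_cell n z.

Lemma maps_mem A m : mapsM f A m -> A ∈ F /\ m ∈ w.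
Proof. exact (bijection_mem _ _ _ _ _ Hf). Qed.

Lemma open_sub A z : A ∈ T -> z ∈ A -> z ∈ X.
Proof. intros HA; now apply HT. Qed.

Lemma in_cell_disjoint n m z : n ∈ w -> m ∈ w ->
  in_cell n z -> in_cell m z -> n = m.
Proof.
  (* The neighborhood that keeps [z] off the tail of the smaller index misses the member of the
     larger index. The larger index is not 0, so that member is a set of the family and contains
     [z]. *)
  assert (Hlt : forall n m, n ∈ m -> in_cell n z -> in_cell m z -> False).
  { intros a b Hab [_ [U [HU [HzU HfU]]]] [[_ [Hb|[A [HA HzA]]]] _].
    - exact (Hb _ Hab).
    - apply (HfU A b HA Hab); now exists z. }
  intros Hn Hm Hz Hz'.
  destruct (omega_linear n m Hn Hm) as [H|[H|H]]; auto; destruct (Hlt _ _ H); auto.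
Qed.

Lemma cell_unique n D D' : cell n D -> cell n D' -> D = D'.
Proof.
  intros H H'; apply extensionality; intros z; now rewrite (H z), (H' z).
Qed.

Lemma cell_exists n : exists D, D ∈ T /\ cell n D.
Proof.
  separate X by (fun z : M => in_cell n z) as D HD.
  assert (HDc : cell n D).
  { intros z; rewrite (HD z); split; [tauto|]; intros Hz; split; auto; apply Hz. }
  exists D; split; auto.
  apply (open_of_local X T D HT).
  intros z Hz; apply HDc in Hz; destruct Hz as [[HzX Hz] [U [HU [HzU HfU]]]].
  assert (HA : exists A, A ∈ T /\ z ∈ A /\ forall y, y ∈ A -> member n y).
  { destruct Hz as [Hn|[A [HA HzA]]].
    - exists X; repeat split; auto; apply HT.
    - assert (HAT : A ∈ T) by (apply Fopen, (maps_mem _ _ HA)).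
      exists A; repeat split; auto; [eapply open_sub; eauto|].
      right; now exists A. }
  destruct HA as [A [HA [HzA HAm]]].
  destruct (open_inter X T A U HT HA HU) as [V [HV HVi]].
  exists V; split; auto; split; [apply HVi; auto|].
  intros y Hy; apply HVi in Hy; apply HDc; split; [apply HAm; tauto|].
  exists U; tauto.
Qed.

(** Local finiteness in terms of indices: only finitely many members meet [U], and finitely many
    numbers have a strict upper bound, built up as a maximum of successors. *)
Lemma local_bound x : x ∈ X ->
  exists U k, U ∈ T /\ x ∈ U /\ k ∈ w /\
    forall A m, mapsM f A m -> meetsM A U -> m ∈ k.
Proof.
  intros Hx; destruct (proj2 HF x Hx) as [N [[_ [U [HU [HxU HUN]]]] [G [HG Gfin]]]].
  assert (Hb : subsetM G F -> exists k, k ∈ w /\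
    forall A m, A ∈ G -> mapsM f A m -> m ∈ k).
  { clear HG; revert G Gfin; by_finite_ind.
    - intros e He _; exists e; split; [now apply omega_empty|].
      intros A m HA; destruct (He _ HA).
    - intros a b A IH Hb HbF; destruct IH as [k [Hk IH]].
      { intros B HB; apply HbF, Hb; auto. }
      destruct (proj1 (proj2 Hf) A) as [m [HAm HAu]]; [apply HbF, Hb; auto|].
      assert (Hm := proj2 (maps_mem _ _ HAm)).
      assert (HbA : forall k', (forall l, l ∈ k -> l ∈ k') -> m ∈ k' ->
        forall B l, B ∈ b -> mapsM f B l -> l ∈ k').
      { intros k' Hkk' Hmk' B l HB HBl; apply Hb in HB; destruct HB as [HB| ->].
        - eauto.
        - now rewrite (HAu _ HBl). }
      destruct (succ_exists m) as [s Hs].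
      assert (Hsw := omega_succ _ _ Hm Hs).
      destruct (omega_linear k s Hk Hsw) as [H|[H|H]].
      + exists s; split; auto; apply HbA; [|now apply mem_succ].
        intros l Hl; eapply omega_mem_trans; eauto.
      + subst s; exists k; split; auto; apply HbA; auto; now apply mem_succ.
      + exists k; split; auto; apply HbA; auto.
        eapply omega_mem_trans; eauto; now apply mem_succ. }
  destruct Hb as [k [Hk Hb]]; [intros A HA; now apply HG|].
  exists U, k; repeat split; auto.
  intros A m HA [z [HzA HzU]]; apply (Hb A m); auto.
  apply HG; split; [apply (maps_mem _ _ HA)|]; exists z; auto.
Qed.

(* [m] is the largest index of a member meeting a suitable neighborhood of [z]. *)
Lemma meets_cell V n z : V ∈ T -> n ∈ w -> z ∈ V -> member n z ->
  exists m y, m ∈ w /\ (m = n \/ n ∈ m) /\ y ∈ V /\ in_cell m y.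
Proof.
  intros HV Hn HzV Hz.
  (* Induction on a strict bound [k] for the indices above [n] of members meeting [U]. At 0 the
     point [z] itself lies in cell [n]. At a successor, either the last admissible member meets [U],
     and any common point lies in its cell, or the bound drops. *)
  assert (Hind : forall k, k ∈ w -> forall U,
    U ∈ T -> z ∈ U ->
    (forall A m, mapsM f A m -> n ∈ m -> meetsM A U -> m ∈ k) ->
    exists m y, m ∈ w /\ (m = n \/ n ∈ m) /\ y ∈ U /\ in_cell m y).
  { by_omega_ind.
    - intros e He U HU HzU Hb; exists n, z; repeat split; auto; try apply Hz.
      exists U; repeat split; auto.
      intros A m HA Hnm HAU; exact (He m (Hb A m HA Hnm HAU)).
    - intros k s Hk IH Hs U HU HzU Hb.
      destruct (classic (exists A, mapsM f A k /\ n ∈ k /\ meetsM A U))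
        as [[A [HA [Hnk [y [HyA HyU]]]]]|Hno].
      + exists k, y; repeat split; auto.
        * apply (open_sub U); auto.
        * right; now exists A.
        * exists U; repeat split; auto.
          intros B m HB Hkm HBU.
          assert (Hm := proj2 (maps_mem _ _ HB)).
          assert (Hms : m ∈ s)
            by (apply (Hb B m HB); auto; eapply omega_mem_trans; eauto).
          apply Hs in Hms; destruct Hms as [Hmk| ->].
          -- apply (omega_irrefl k Hk); eapply omega_mem_trans; eauto.
          -- exact (omega_irrefl k Hk Hkm).
      + apply IH; auto.
        intros A m HA Hnm HAU; assert (Hms := Hb A m HA Hnm HAU).
        apply Hs in Hms; destruct Hms as [Hms| ->]; auto.
        destruct Hno; exists A; auto. }
  destruct (local_bound z (open_sub _ _ HV HzV)) as [U [k [HU [HzU [Hk Hb]]]]].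
  destruct (open_inter X T U V HT HU HV) as [W [HW HWi]].
  destruct (Hind k Hk W HW) as [m [y [Hm [Hnm [HyW Hy]]]]].
  - apply HWi; auto.
  - intros A m HA _ [y [HyA HyW]]; apply (Hb A m HA); exists y; split; auto.
    now apply HWi.
  - exists m, y; repeat split; auto; try apply Hy; now apply HWi.
Qed.

(** The enumeration is injective, so the members [k] and [k + 1] are not both empty. A point of a
    nonempty one gives, by [meets_cell] in the open set [X], a nonempty cell of at least that
    index. *)
Lemma cells_unbounded k : k ∈ w ->
  exists n, n ∈ w /\ (n = k \/ k ∈ n) /\ exists z, in_cell n z.
Proof.
  intros Hk; destruct (succ_exists k) as [s Hs].
  assert (Hsw := omega_succ _ _ Hk Hs); assert (Hks := mem_succ _ _ Hs).
  assert (Hne : exists n A z, n ∈ w /\ (n = k \/ k ∈ n) /\ mapsM f A n /\ z ∈ A).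
  { destruct (proj2 (proj2 Hf) k Hk) as [A [HA _]].
    destruct (proj2 (proj2 Hf) s Hsw) as [B [HB _]].
    destruct (empty_or_inhabited A) as [HAe|[z Hz]]; [|exists k, A, z; auto].
    destruct (empty_or_inhabited B) as [HBe|[z Hz]]; [|exists s, B, z; auto].
    rewrite (empty_unique _ _ HBe HAe) in HB.
    rewrite (bijection_fun _ _ _ _ _ _ Hf HB HA) in Hks.
    destruct (omega_irrefl k Hk Hks). }
  destruct Hne as [n [A [z [Hn [Hkn [HA HzA]]]]]].
  assert (HzX : z ∈ X).
  { apply (open_sub A); auto; apply Fopen, (maps_mem _ _ HA). }
  destruct (meets_cell X n z) as [m [y [Hm [Hnm [_ Hy]]]]]; auto.
  - apply HT.
  - split; auto; right; now exists A.
  - exists m; split; auto; split; [|now exists y].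
    destruct Hkn as [-> |Hkn]; auto.
    right; destruct Hnm as [-> |Hnm]; auto; eapply omega_mem_trans; eauto.
Qed.

Lemma cells_below_finite k : k ∈ w ->
  forall G, (forall D, D ∈ G -> exists n, n ∈ k /\ cell n D) -> finiteM G.
Proof.
  revert k; by_omega_ind.
  - intros e He G HG; apply finite_empty; intros D HD.
    destruct (HG D HD) as [n [Hn _]]; exact (He n Hn).
  - intros k s Hk IH Hs G HG.
    destruct (cell_exists k) as [D [_ HD]].
    separate G by (fun D' : M => ~ D' = D) as G' HG'.
    assert (HG'f : finiteM G').
    { apply IH; intros D' HD'; apply HG' in HD'; destruct HD' as [HD' Hne].
      destruct (HG D' HD') as [n [Hn Hc]]; exists n; split; auto.
      apply Hs in Hn; destruct Hn as [Hn| ->]; auto.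
      destruct Hne; eapply cell_unique; eauto. }
    destruct (adjoin_exists G' D) as [G'' HG''].
    apply (finite_subset G''); [eapply finite_adjoin; eauto|].
    intros D' HD'; apply HG''; destruct (classic (D' = D)); auto.
    left; apply HG'; auto.
Qed.

(** A point outside the cell has an open neighborhood missing it: a later member that contains the
    point, or the complement of the [n]-th set. A point of member [n] in no later member cannot
    occur, since the tail union of clopen sets is closed by local finiteness. *)
Lemma cell_clopen n D : clopen_familyM X T F -> D ∈ T -> cell n D -> clopenM X T D.
Proof.
  intros HFc HD HDc; split; auto.
  destruct (diff_exists X D) as [C HC]; exists C; split; auto.
  apply (open_of_local X T C HT); intros z Hz; apply HC in Hz; destruct Hz as [HzX HzD].
  assert (Hsub : forall V, V ∈ T -> z ∈ V ->
    (forall y, y ∈ V -> ~ in_cell n y) -> exists V, V ∈ T /\ z ∈ V /\ subsetM V C).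
  { intros V HV HzV H; exists V; repeat split; auto.
    intros y Hy; apply HC; split; [eapply open_sub; eauto|].
    intros HyD; apply (H y Hy), HDc, HyD. }
  destruct (classic (member n z)) as [Hz|Hz].
  - destruct (classic (exists A m, mapsM f A m /\ n ∈ m /\ z ∈ A))
      as [[A [m [HA [Hnm HzA]]]]|Hno].
    + apply (Hsub A); auto; [apply Fopen, (maps_mem _ _ HA)|].
      intros y HyA [_ [U [HU [HyU HfU]]]]; apply (HfU A m HA Hnm); now exists y.
    + destruct HzD; apply HDc; split; auto.
      destruct (local_bound z HzX) as [U [k [HU [HzU [Hk Hb]]]]].
      (* The open complements of the members with index above [n] and below [j] are intersected one
         at a time; from index [k] on, [U] already misses every member. *)
      assert (Hj : forall j, j ∈ w -> exists V, V ∈ T /\ z ∈ V /\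
        forall A m, mapsM f A m -> n ∈ m -> m ∈ j -> ~ meetsM A V).
      { clear k Hk Hb; by_omega_ind.
        - intros e He; exists U; repeat split; auto.
          intros A m _ _ Hm; destruct (He _ Hm).
        - intros j s Hj [V [HV [HzV HfV]]] Hs.
          destruct (proj2 (proj2 Hf) j Hj) as [A [HA HAu]].
          destruct (classic (n ∈ j)) as [Hnj|Hnj].
          + destruct (HFc A) as [HAT [B [HB HBT]]]; [apply (maps_mem _ _ HA)|].
            destruct (open_inter X T V B HT HV HBT) as [W [HW HWi]].
            exists W; split; auto; split.
            * apply HWi; split; auto; apply HB; split; auto.
              intros HzA; apply Hno; exists A, j; auto.
            * intros A' m HA' Hnm Hms [y [HyA HyW]]; apply HWi in HyW.
              apply Hs in Hms; destruct Hms as [Hmj| ->].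
              -- apply (HfV A' m HA' Hnm Hmj); exists y; tauto.
              -- rewrite (HAu _ HA') in HyA; destruct HyW as [_ HyB].
                 apply HB in HyB; tauto.
          + exists V; repeat split; auto.
            intros A' m HA' Hnm Hms; apply Hs in Hms; destruct Hms as [Hmj| ->].
            * eauto.
            * tauto. }
      destruct (Hj k Hk) as [V [HV [HzV HfV]]].
      destruct (open_inter X T U V HT HU HV) as [W [HW HWi]].
      exists W; split; auto; split; [apply HWi; auto|].
      intros A m HA Hnm [y [HyA HyW]]; apply HWi in HyW.
      apply (HfV A m HA Hnm); [|exists y; tauto].
      apply (Hb A m HA); exists y; tauto.
  - assert (Hn : ~ emptyM n) by (intros Hn; apply Hz; split; auto).
    destruct (classic (exists A, mapsM f A n)) as [[A HA]|HA].
    + destruct (HFc A) as [HAT [B [HB HBT]]]; [apply (maps_mem _ _ HA)|].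
      apply (Hsub B); auto.
      * apply HB; split; auto; intros HzA; apply Hz; split; auto.
        right; now exists A.
      * intros y Hy [[_ [He|[A' [HA' HyA']]]] _]; [tauto|].
        rewrite (bijection_inj _ _ _ _ _ _ Hf HA' HA) in HyA'.
        apply HB in Hy; tauto.
    (* If no set has the nonzero index [n], the cell is empty and all of [X] misses it. *)
    + apply (Hsub X); auto; [apply HT|].
      intros y Hy [[_ [He|[A' [HA' HyA']]]] _]; [tauto|].
      destruct HA; now exists A'.
Qed.

Lemma cells_solution : exists K,
  denumerableM K /\ cellularM T K /\ locally_finiteM X T K /\
  has_dense_unionM X T K /\
  (clopen_familyM X T F -> clopen_familyM X T K).
Proof.
  separate T by (fun D : M => (exists z, z ∈ D) /\ exists n, n ∈ w /\ cell n D) as K HK.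
  separate w by (fun n : M => exists z, in_cell n z) as S HS.
  exists K; split; [|split; [|split; [|split]]].
  - exists w; split; auto.
    destruct (unbounded_denumerable S) as [g Hg].
    { intros n Hn; now apply HS. }
    { intros k Hk; destruct (cells_unbounded k Hk) as [n [Hn [Hkn Hz]]].
      exists n; split; auto; apply HS; auto. }
    destruct (product_exists K w) as [P HP].
    (* A nonempty cell determines its index by disjointness; this index is sent on by [g], the
       enumeration of the index set [S]. *)
    separate P by (fun p : M => exists D k n, opairM p D k /\ cell n D /\ mapsM g n k)
      as h Hh.
    assert (Hm : forall D k, mapsM h D k <-> D ∈ K /\ exists n, cell n D /\ mapsM g n k).
    { intros D k; split.
      - intros [p [Hp H]]; apply Hh in H; destruct H as [H [D' [k' [n [Hp' H']]]]].
        destruct (opair_inj _ _ _ _ _ Hp Hp') as [<- <-].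
        apply HP in H; destruct H as [D' [k' [HD [Hk Hp'']]]].
        destruct (opair_inj _ _ _ _ _ Hp Hp'') as [<- <-].
        split; auto; now exists n.
      - intros [HD [n [Hn Hnk]]]; destruct (opair_exists D k) as [p Hp].
        exists p; split; auto; apply Hh; split; [|exists D, k, n; auto].
        apply HP; exists D, k; repeat split; auto.
        apply (bijection_mem _ _ _ _ _ Hg Hnk). }
    assert (HKS : forall D n, D ∈ K -> n ∈ w -> cell n D -> n ∈ S).
    { intros D n HD Hn Hc; apply HK in HD; destruct HD as [_ [[z Hz] _]].
      apply HS; split; auto; exists z; now apply Hc. }
    assert (Hgw : forall n k, mapsM g n k -> n ∈ w).
    { intros n k Hnk; apply HS; apply (bijection_mem _ _ _ _ _ Hg Hnk). }
    exists h; apply bijection_intro.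
    + intros p Hp; apply Hh in Hp; destruct Hp as [Hp _]; now apply HP.
    + intros D HD; assert (HD' := HD); apply HK in HD'.
      destruct HD' as [_ [_ [n [Hn Hc]]]].
      destruct (proj1 (proj2 Hg) n (HKS D n HD Hn Hc)) as [k [Hk _]].
      exists k; apply Hm; split; auto; now exists n.
    + intros k Hk; destruct (proj2 (proj2 Hg) k Hk) as [n [Hn _]].
      assert (HnS := proj1 (bijection_mem _ _ _ _ _ Hg Hn)).
      apply HS in HnS; destruct HnS as [Hnw [z Hz]].
      destruct (cell_exists n) as [D [HDT HD]].
      exists D; apply Hm; split; [|now exists n].
      apply HK; split; auto; split; [exists z; now apply HD|now exists n].
    + intros D k k' H H'; apply Hm in H, H'.
      destruct H as [HD [n [Hn Hk]]], H' as [_ [n' [Hn' Hk']]].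
      apply HK in HD; destruct HD as [_ [[z Hz] _]].
      assert (n' = n) as ->.
      { apply (in_cell_disjoint n' n z); eauto; [now apply Hn' | now apply Hn]. }
      eapply bijection_fun; eauto.
    + intros D D' k H H'; apply Hm in H, H'.
      destruct H as [HD [n [Hn Hk]]], H' as [_ [n' [Hn' Hk']]].
      rewrite (bijection_inj _ _ _ _ _ _ Hg Hk' Hk) in Hn'.
      eapply cell_unique; eauto.
  - split.
    + intros D HD; apply HK in HD; tauto.
    + intros D D' HD HD' Hne [z [Hz Hz']]; apply Hne.
      apply HK in HD, HD'.
      destruct HD as [_ [_ [n [Hn Hc]]]], HD' as [_ [_ [n' [Hn' Hc']]]].
      assert (n = n') as ->.
      { apply (in_cell_disjoint n n' z); auto; [now apply Hc | now apply Hc']. }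
      eapply cell_unique; eauto.
  - split.
    + intros D HD; apply HT; now apply HK.
    + intros x Hx; destruct (local_bound x Hx) as [U [k [HU [HxU [Hk Hb]]]]].
      exists U; split.
      * split; [now apply HT|]; exists U; repeat split; auto; now intros z.
      * separate K by (fun D : M => meetsM D U) as G HG; exists G; split; auto.
        (* The successor leaves room for index 0: its member is [X], which [local_bound] does not
           control, and [k] may be 0. *)
        destruct (succ_exists k) as [s Hs].
        apply (cells_below_finite s); [eapply omega_succ; eauto|].
        intros D HD; apply HG in HD; destruct HD as [HD [z [HzD HzU]]].
        apply HK in HD; destruct HD as [_ [_ [n [Hn Hc]]]].
        exists n; split; auto; apply Hs.
        apply Hc in HzD; destruct HzD as [[_ [He|[A [HA HzA]]]] _].
        -- destruct (omega_zero_le n k He Hk); auto.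
        -- left; apply (Hb A n HA); now exists z.
  - destruct (union_exists K) as [D HD]; exists D; split; auto; split.
    + intros z Hz; apply HD in Hz; destruct Hz as [C [HC Hz]].
      apply HK in HC; eapply open_sub; [apply HC | exact Hz].
    (* Every point of [X] belongs to the member of index 0, so [meets_cell] applies to any nonempty
       open set. *)
    + intros U HU [z Hz]; destruct (empty_exists z) as [e He].
      destruct (meets_cell U e z HU (omega_empty e He) Hz) as [m [y [Hm [_ [HyU Hy]]]]].
      { split; [eapply open_sub; eauto | auto]. }
      destruct (cell_exists m) as [C [HCT HC]].
      assert (HyC : y ∈ C) by now apply HC.
      exists y; split; auto; apply HD; exists C; split; auto.
      apply HK; split; auto; split; [now exists y | now exists m].
  - intros HFc D HD; apply HK in HD; destruct HD as [HD [_ [n [_ Hc]]]].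
    eapply cell_clopen; eauto.
Qed.

End Enumerated.

(** * Infinite locally finite families *)

Section Unenumerated.
Variables X T F : M.
Hypothesis HT : topologyM X T.
Hypothesis HF : locally_finiteM X T F.
Hypothesis Fopen : open_familyM T F.

Definition homogeneous (V : M) :=
  V ∈ T /\ (exists z, z ∈ V) /\ forall A, A ∈ F -> meetsM A V -> subsetM V A.
Definition same_trace (V W : M) := forall A, A ∈ F -> subsetM V A <-> subsetM W A.
(** A homogeneous set that contains [C] has the trace of [C] by [same_trace_meet], so this amounts
    to maximality among all homogeneous sets. *)
Definition max_homogeneous (C : M) :=
  homogeneous C /\ forall W, homogeneous W -> same_trace C W -> subsetM W C.

(** A member that contains one of the sets contains the common point, hence meets the other set and
    contains it. *)
Lemma same_trace_meet C C' :
  homogeneous C -> homogeneous C' -> meetsM C C' -> same_trace C C'.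
Proof.
  intros [_ [_ H]] [_ [_ H']] [z [Hz Hz']] A HA; split; intros Hs.
  - apply H'; auto; exists z; auto.
  - apply H; auto; exists z; auto.
Qed.

Lemma max_homogeneous_unique C C' :
  max_homogeneous C -> max_homogeneous C' -> same_trace C C' -> C = C'.
Proof.
  intros [H1 H2] [H1' H2'] Ht; apply extensionality; intros z; split.
  - apply H2'; auto; intros A HA; symmetry; auto.
  - apply H2; auto.
Qed.

(** The union of all homogeneous sets with the trace of [V] is homogeneous with the same trace,
    which gives the maximal set explicitly. *)
Lemma max_homogeneous_exists V :
  homogeneous V -> exists C, max_homogeneous C /\ subsetM V C.
Proof.
  intros HV; separate T by (fun W : M => homogeneous W /\ same_trace V W) as S HS.
  destruct (union_exists S) as [C HC].
  assert (HVS : V ∈ S).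
  { apply HS; split; [exact (proj1 HV)|split; [exact HV|intros A HA; tauto]]. }
  assert (HSC : forall W, W ∈ S -> subsetM W C).
  { intros W HW z Hz; apply HC; now exists W. }
  assert (HCA : forall A, A ∈ F -> subsetM V A -> subsetM C A).
  { intros A HA HVA z Hz; apply HC in Hz; destruct Hz as [W [HW Hz]].
    apply HS in HW; destruct HW as [_ [_ HW]].
    exact (proj1 (HW A HA) HVA z Hz). }
  exists C; split; [split; [split; [|split]|]|]; auto.
  - destruct HT as [_ [_ [_ [HU _]]]]; apply (HU S); auto.
    intros W HW; apply HS in HW; tauto.
  - destruct HV as [_ [[z Hz] _]]; exists z; now apply (HSC V).
  - intros A HA [z [HzA HzC]]; apply HCA; auto.
    apply HC in HzC; destruct HzC as [W [HW HzW]].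
    apply HS in HW; destruct HW as [_ [[_ [_ HW]] HVW]].
    apply (HVW A HA), HW; auto; now exists z.
  - intros W HW Ht; apply HSC, HS; split; [exact (proj1 HW)|split; auto].
    intros A HA; rewrite <- (Ht A HA); split; auto.
    intros HCA' z Hz; apply HCA'; now apply (HSC V).
Qed.

Lemma homogeneous_below V : V ∈ T -> (exists z, z ∈ V) ->
  exists W, homogeneous W /\ subsetM W V.
Proof.
  intros HV [x Hx].
  assert (HxX : x ∈ X) by (revert Hx; now apply HT).
  destruct (proj2 HF x HxX) as [N [[_ [U [HU [HxU HUN]]]] [G [HG Gfin]]]].
  (* [G] holds the members still to be treated; the others contain [V] or miss it. A member of [G]
     that meets [V] is treated by intersecting [V] with it. *)
  assert (Hind : forall V, V ∈ T -> (exists z, z ∈ V) ->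
    (forall A, A ∈ F -> meetsM A V -> A ∈ G \/ subsetM V A) ->
    exists W, homogeneous W /\ subsetM W V).
  { clear HG V HV Hx; revert G Gfin; by_finite_ind.
    - intros e He V HV Hne H; exists V; split; [|now intros z].
      split; auto; split; auto.
      intros A HA HAV; destruct (H A HA HAV) as [H'|H']; auto; destruct (He _ H').
    - intros a b B IH Hb V HV Hne H.
      destruct (classic (B ∈ F /\ meetsM B V)) as [[HB [y [HyB HyV]]]|Hno].
      + destruct (open_inter X T V B HT HV (Fopen B HB)) as [V1 [HV1 HV1i]].
        destruct (IH V1 HV1) as [W [HW HWV]].
        * exists y; apply HV1i; auto.
        * intros A HA [z [HzA HzV]]; apply HV1i in HzV.
          destruct (H A HA) as [HAb|HAV]; [exists z; tauto| |].
          -- apply Hb in HAb; destruct HAb as [HAb| ->]; auto.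
             right; intros t Ht; now apply HV1i.
          -- right; intros t Ht; apply HAV; now apply HV1i.
        * exists W; split; auto; intros t Ht; apply HV1i; auto.
      + apply IH; auto.
        intros A HA HAV; destruct (H A HA HAV) as [HAb|]; auto.
        apply Hb in HAb; destruct HAb as [HAb| ->]; auto; tauto. }
  destruct (open_inter X T U V HT HU HV) as [V1 [HV1 HV1i]].
  destruct (Hind V1 HV1) as [W [HW HWV]].
  - exists x; apply HV1i; auto.
  - intros A HA [z [HzA HzV]]; left; apply HG; split; auto.
    exists z; split; auto; apply HUN; now apply HV1i.
  - exists W; split; auto; intros z Hz; apply HV1i; auto.
Qed.

(** The trace on [G] embeds [K] into the power set of [G]. Dropping [B] from [G] splits [K] into the
    sets inside [B] and the rest, and in each half the remaining traces still separate. *)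
Lemma finite_of_traces G K :
  finiteM G ->
  (forall C C', C ∈ K -> C' ∈ K ->
     (forall A, A ∈ G -> subsetM C A <-> subsetM C' A) -> C = C') ->
  finiteM K.
Proof.
  intros HG; revert K; revert G HG; by_finite_ind.
  - intros e He K HK.
    destruct (classic (exists C, C ∈ K)) as [[C HC]|Hno].
    + destruct (adjoin_exists e C) as [K' HK'].
      apply (finite_subset K').
      * eapply finite_adjoin; [apply finite_empty, He | exact HK'].
      * intros C' HC'; apply HK'; right; apply HK; auto.
        intros A HA; destruct (He _ HA).
    + apply finite_empty; intros C HC; eauto.
  - intros a b B IH Hb K HK.
    separate K by (fun C : M => subsetM C B) as K1 HK1.
    separate K by (fun C : M => ~ subsetM C B) as K2 HK2.
    apply (finite_union2 K1 K2); [apply IH | apply IH |].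
    + intros C C' HC HC' H; apply HK1 in HC, HC'; apply HK; try tauto.
      intros A HA; apply Hb in HA; destruct HA as [HA| ->]; auto; tauto.
    + intros C C' HC HC' H; apply HK2 in HC, HC'; apply HK; try tauto.
      intros A HA; apply Hb in HA; destruct HA as [HA| ->]; auto; tauto.
    + intros C; rewrite (HK1 C), (HK2 C); tauto.
Qed.

Lemma point_finite x G : x ∈ X ->
  (forall A, A ∈ G -> A ∈ F /\ x ∈ A) -> finiteM G.
Proof.
  intros Hx HG; destruct (proj2 HF x Hx) as [N [[_ [U [_ [HxU HUN]]]] [H [HH Hfin]]]].
  apply (finite_subset H _ Hfin); intros A HA; destruct (HG A HA) as [HAF HxA].
  apply HH; split; auto; exists x; auto.
Qed.

Lemma finite_of_finite_meeting K :
  finiteM K -> (forall C, C ∈ K -> homogeneous C) ->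
  forall G, (forall A, A ∈ G -> A ∈ F /\ exists C, C ∈ K /\ meetsM A C) -> finiteM G.
Proof.
  revert K; by_finite_ind.
  - intros e He _ G HG; apply finite_empty; intros A HA.
    destruct (HG A HA) as [_ [C [HC _]]]; exact (He C HC).
  - intros a b C IH Hb Hgood G HG.
    separate G by (fun A : M => meetsM A C) as G1 HG1.
    separate G by (fun A : M => ~ meetsM A C) as G2 HG2.
    apply (finite_union2 G1 G2).
    + destruct (Hgood C) as [HCT [[x Hx] HC]]; [apply Hb; auto|].
      apply (point_finite x); [revert Hx; now apply HT|].
      intros A HA; apply HG1 in HA; destruct HA as [HA HAC].
      assert (HAF := proj1 (HG A HA)); split; auto; now apply (HC A HAF HAC).
    + apply IH; [intros C' HC'; apply Hgood, Hb; auto|].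
      intros A HA; apply HG2 in HA; destruct HA as [HA HAC].
      destruct (HG A HA) as [HAF [C' [HC' HAC']]]; split; auto.
      exists C'; split; auto; apply Hb in HC'; destruct HC' as [HC'| ->]; tauto.
    + intros A; rewrite (HG1 A), (HG2 A); tauto.
Qed.

Lemma homogeneous_solution : infiniteM F -> exists K,
  infiniteM K /\ locally_finiteM X T K /\ cellularM T K /\ has_dense_unionM X T K.
Proof.
  intros Finf; separate T by (fun C : M => max_homogeneous C) as K HK.
  assert (Hmeet : forall U, U ∈ T -> (exists z, z ∈ U) -> exists C, C ∈ K /\ meetsM U C).
  { intros U HU Hne; destruct (homogeneous_below U HU Hne) as [V [HV HVU]].
    destruct (max_homogeneous_exists V HV) as [C [HC HVC]].
    exists C; split; [apply HK; split; auto; exact (proj1 (proj1 HC))|].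
    destruct HV as [_ [[z Hz] _]]; exists z; auto. }
  exists K; split; [|split; [|split]].
  (* Every nonempty member of [F] is open and so meets a set of [K]. A finite [K] would leave
     finitely many nonempty members, and the empty set adds at most one more. *)
  - intros Kfin; apply Finf.
    separate F by (fun A : M => exists z, z ∈ A) as G HG.
    assert (Gfin : finiteM G).
    { apply (finite_of_finite_meeting K Kfin).
      - intros C HC; apply HK in HC; exact (proj1 (proj2 HC)).
      - intros A HA; apply HG in HA; destruct HA as [HA Hne]; auto. }
    destruct (empty_exists X) as [e He], (adjoin_exists G e) as [H HH].
    apply (finite_subset H); [eapply finite_adjoin; eauto|].
    intros A HA; apply HH; destruct (empty_or_inhabited A) as [HAe|HAi].
    + right; now apply empty_unique.
    + left; apply HG; auto.
  - split; [intros C HC; apply HT; now apply HK|].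
    intros x Hx; destruct (proj2 HF x Hx) as [N [HN [G [HG Gfin]]]].
    exists N; split; auto.
    separate K by (fun C : M => meetsM C N) as L HL; exists L; split; auto.
    (* The neighborhood that works for [F] works for [K]: a member containing a set that meets [N]
       meets [N] itself, so the traces on [G] determine the full traces of the sets in [L]. *)
    apply (finite_of_traces G L Gfin).
    intros C C' HC HC' H; apply HL in HC, HC'.
    destruct HC as [HC HCN], HC' as [HC' HCN']; apply HK in HC, HC'.
    apply max_homogeneous_unique; try tauto.
    assert (Hin : forall D A, A ∈ F -> meetsM D N -> subsetM D A -> A ∈ G).
    { intros D A HA [z [HzD HzN]] HDA; apply HG; split; auto; exists z; auto. }
    intros A HA; split; intros HCA; [apply (H A) | apply (H A)]; eauto.
  - split.
    + intros C HC; apply HK in HC; destruct HC as [HC [HC' _]].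
      split; auto; exact (proj1 (proj2 HC')).
    + intros C C' HC HC' Hne Hm; apply Hne; apply HK in HC, HC'.
      apply max_homogeneous_unique; try tauto.
      apply same_trace_meet; auto; [apply HC | apply HC'].
  - destruct (union_exists K) as [D HD]; exists D; split; auto; split.
    + intros z Hz; apply HD in Hz; destruct Hz as [C [HC Hz]].
      apply HK in HC; revert Hz; now apply HT.
    + intros U HU Hne; destruct (Hmeet U HU Hne) as [C [HC [z [HzU HzC]]]].
      exists z; split; auto; apply HD; now exists C.
Qed.

End Unenumerated.
End Model.

(** * The three equivalences in a model and their derivability *)

Lemma model_theorem (M : Type) (E : M -> M -> Prop)
    (ZF_model : forall q, ZF q -> forall v, sat E v q) (X T : M) :
  topologyM M E X T -> infiniteM M E X ->
  ((exists F, denumerableM M E F /\ locally_finiteM M E X T F /\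
      clopen_familyM M E X T F) <->
   (exists F, denumerableM M E F /\ cellularM M E T F /\
      locally_finiteM M E X T F /\ clopen_familyM M E X T F)) /\
  ((exists F, denumerableM M E F /\ locally_finiteM M E X T F /\
      cellularM M E T F /\ has_dense_unionM M E X T F) <->
   (exists F, denumerableM M E F /\ locally_finiteM M E X T F /\
      open_familyM M E T F)) /\
  ((exists F, infiniteM M E F /\ locally_finiteM M E X T F /\
      cellularM M E T F /\ has_dense_unionM M E X T F) <->
   (exists F, infiniteM M E F /\ locally_finiteM M E X T F /\
      open_familyM M E T F)).
Proof.
  intros HT _.
  (* One family of cells serves both (i) and (ii). *)
  assert (Hden : forall F, denumerableM M E F -> locally_finiteM M E X T F ->
    open_familyM M E T F -> exists K,
      denumerableM M E K /\ cellularM M E T K /\ locally_finiteM M E X T K /\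
      has_dense_unionM M E X T K /\
      (clopen_familyM M E X T F -> clopen_familyM M E X T K)).
  { intros F [w [Hw [f Hf]]] HF Fopen.
    exact (cells_solution M E ZF_model w Hw X T F f HT Hf HF Fopen). }
  split; [|split]; split.
  - intros [F [Fden [HF Fclopen]]].
    destruct (Hden F Fden HF) as [K HK]; [intros A HA; now apply Fclopen|].
    exists K; tauto.
  - intros [F HF]; exists F; tauto.
  - intros [F [Fden [HF [Fcell _]]]]; exists F; repeat split; auto; try apply HF.
    intros A HA; now apply Fcell.
  - intros [F [Fden [HF Fopen]]]; destruct (Hden F Fden HF Fopen) as [K HK].
    exists K; tauto.
  - intros [F [Finf [HF [Fcell _]]]]; exists F; repeat split; auto; try apply HF.
    intros A HA; now apply Fcell.
  - intros [F [Finf [HF Fopen]]]; destruct (omega_exists M E ZF_model X) as [w Hw].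
    exact (homogeneous_solution M E ZF_model w Hw X T F HT HF Fopen Finf).
Qed.

Local Open Scope zf_scope.

Theorem theorem3p1 :
  provable_in_ZF (
    ∀ X T, topology X T → infinite X →
      ((∃ F, denumerable F ∧ locally_finite X T F ∧ clopen_family X T F) ↔
       (∃ F, denumerable F ∧ cellular T F ∧ locally_finite X T F ∧
             clopen_family X T F)) ∧
      ((∃ F, denumerable F ∧ locally_finite X T F ∧ cellular T F ∧
             has_dense_union X T F) ↔
       (∃ F, denumerable F ∧ locally_finite X T F ∧ open_family T F)) ∧
      ((∃ F, infinite F ∧ locally_finite X T F ∧ cellular T F ∧
             has_dense_union X T F) ↔
       (∃ F, infinite F ∧ locally_finite X T F ∧ open_family T F))).
Proof.
  apply completeness; intros M E ZF_model v.
  (* Satisfaction of the closed formula unfolds, under any valuation, to the statement about the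
     model. *)
  exact (model_theorem M E ZF_model).
Qed.
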